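(* Let $T_0,\mu_1,\mu_2$ be positive real numbers with $\mu_2>\mu_1$, let $\omega$ be a modulus of continuity, and let $\theta:(0,T_0)\to(0,+\infty)$ be a continuous and nonincreasing function. For every $\lambda>0$ let $$m(\lambda):=\min\left\{\lambda\,\omega\left(\frac1\lambda\right)s+\int_s^{T_0}\theta(t)\,dt:\ s\in[0,T_0]\right\}.$$ Set $$M_1:=\left(\frac{\max\{1,\mu_2\}}{\min\{1,\mu_1\}}\right)^2,\qquad M_2:=\frac1{\mu_1}+\frac1{\sqrt{\mu_1}},\qquad M_3:=\frac{1}{128\mu_2}\min\left\{1,\frac{\sqrt{\mu_1}}{\pi}\right\}.$$ Then the following statements hold. (1) For every $c\in\mathcal{PS}(T_0,\mu_1,\mu_2,\omega,\theta)$ and every real $\lambda>0$, every solution $u_\lambda$ of $u_\lambda''(t)+\lambda^2c(t)u_\lambda(t)=0$ on $[0,T_0]$ satisfies $$u_\lambda'(t)^2+\lambda^2u_\lambda(t)^2\le M_1\left(u_\lambda'(0)^2+\lambda^2u_\lambda(0)^2\right)\exp(M_2\,m(\lambda))\qquad\forall t\in[0,T_0].$$ (2) Assume that $m(\lambda)\to+\infty$ as $\lambda\to+\infty$. Then for every sequence of positive real numbers $\lambda_n\to+\infty$, the set of coefficients $c\in\mathcal{PS}(T_0,\mu_1,\mu_2,\omega,\theta)$ such that the solutions $u_{\lambda}$ of $u_{\lambda}''(t)+\lambda^2c(t)u_{\lambda}(t)=0$ with $u_{\lambda}(0)=0$, $u_{\lambda}'(0)=1$ satisfy $$\limsup_{n\to+\infty}\left(|u_{\lambda_n}'(t)|^2+\lambda_n^2|u_{\lambda_n}(t)|^2\right)\exp\left(-M_3\,m(\lambda_n)\right)\ge1\qquad\forall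 t\in(0,T_0]$$ is residual in $\mathcal{PS}(T_0,\mu_1,\mu_2,\omega,\theta)$.
   Context: A modulus of continuity is a function $\omega:[0,+\infty)\to[0,+\infty)$ such that $\omega(\sigma)>0$ for $\sigma>0$, $\omega(\sigma)\to0$ as $\sigma\to0^+$, $\sigma\mapsto\omega(\sigma)$ is nondecreasing, and $\sigma\mapsto\sigma/\omega(\sigma)$ is nondecreasing (for $\sigma>0$). $\mathcal{PS}(T_0,\mu_1,\mu_2,\omega,\theta)$ is the set of functions $c\in W^{1,\infty}_{loc}((0,T_0))$ (extended by continuity to $[0,T_0]$) such that $\mu_1\le c(t)\le\mu_2$ for every $t$; $|c(t)-c(s)|\le\omega(|t-s|)$ for all $t,s\in[0,T_0]$; and $|c'(t)|\le\theta(t)$ for almost every $t\in(0,T_0)$. It is a complete metric space with the distance induced by the norm of $L^\infty((0,T_0))$; ''residual'' is meant in this metric space in the sense of Baire category (the set contains a countable intersection of dense open sets). The integral $\int_0^{T_0}\theta(t)\,dt$ may be $+\infty$. *)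

(* Defs.v *)
From HB Require Import structures.
From mathcomp Require Import all_boot all_order all_algebra.
From mathcomp Require Import all_classical all_reals all_analysis.
From mathcomp Require Import ess_sup_inf measurable_realfun.

Set Implicit Arguments.
Unset Strict Implicit.
Unset Printing Implicit Defensive.

Import Order.TTheory GRing.Theory Num.Theory.
Import numFieldNormedType.Exports.

Local Open Scope classical_set_scope.
Local Open Scope ring_scope.

(* Functions defined on a subinterval of the reals are represented by total
   functions R -> R; every condition below only involves their values on the
   relevant interval. *)

Record modulus_of_continuity (R : realType) (omega : R -> R) : Prop := {
  modulus_ge0 : forall x, 0 <= x -> 0 <= omega x ;
  modulus_gt0 : forall x, 0 < x -> 0 < omega x ;
  modulus_cvg0 : omega x @[x --> 0^'+] --> 0 ;
  modulus_nondecreasing : {in `[0, +oo[ &, {homo omega : x y / x <= y}} ;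
  modulus_ratio_nondecreasing :
    {in `]0, +oo[ &, {homo (fun x => x / omega x) : x y / x <= y}} }.

Definition Linfty_loc (R : realType) (a b : R) (f : R -> R) : Prop :=
  measurable_fun `]a, b[ f /\
  forall K : set R, compact K -> K `<=` `]a, b[ ->
    exists M : R, {ae (@lebesgue_measure R), forall t, K t -> `|f t| <= M}.

(* phi is of class C^1 with compact support in (a, b). *)
Definition test_function (R : realType) (a b : R) (phi : R -> R) : Prop :=
  [/\ forall t, derivable phi t 1,
      continuous (derive1 phi) &
      exists K : set R, [/\ compact K, K `<=` `]a, b[ &
        forall t, ~ K t -> phi t = 0]].

(* One-dimensional weak derivative, tested on C^1_c functions as in Brezis,
   Functional Analysis, Sobolev Spaces and PDEs, Section 8.2. *)
Definition weak_derivative (R : realType) (a b : R) (f g : R -> R) : Prop :=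
  forall phi : R -> R, test_function a b phi ->
    \int[lebesgue_measure]_(t in `]a, b[) (f t * derive1 phi t) =
    - \int[lebesgue_measure]_(t in `]a, b[) (g t * phi t).

(* f belongs to W^{1,oo}_loc((a, b)), with weak derivative f'. *)
Definition W1infty_loc (R : realType) (a b : R) (f f' : R -> R) : Prop :=
  [/\ Linfty_loc a b f, Linfty_loc a b f' & weak_derivative a b f f'].

Definition in_PS (R : realType) (T0 mu1 mu2 : R) (omega theta : R -> R)
    (c : R -> R) : Prop :=
  [/\ {within `[0, T0], continuous c},
      {in `[0, T0], forall t, mu1 <= c t <= mu2},
      {in `[0, T0] &, forall t s, `|c t - c s| <= omega `|t - s|} &
      exists2 c' : R -> R, W1infty_loc 0 T0 c c' &
        {ae (@lebesgue_measure R),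
           forall t, t \in `]0, T0[ -> `|c' t| <= theta t}].

Record PS (R : realType) (T0 mu1 mu2 : R) (omega theta : R -> R) := MkPS {
  PS_fun :> R -> R ;
  PS_funP : in_PS T0 mu1 mu2 omega theta PS_fun }.

(* The norm in L^oo((0, T0)) of f - g. *)
Definition Linfty_dist (R : realType) (T0 : R) (f g : R -> R) : \bar R :=
  'N[lebesgue_measure]_+oo[EFin \o ((f \- g) \_ `]0, T0[)%R]%E.

Lemma Linfty_distE (R : realType) (T0 : R) (f g : R -> R) :
  Linfty_dist T0 f g = ess_sup (@lebesgue_measure R)
    (abse \o (EFin \o ((f \- g) \_ `]0, T0[))).
Proof.
have mu_gt0 : (0 < @lebesgue_measure R setT)%E.
  by rewrite -[setT]set_itvNyy lebesgue_measure_itv/= addye.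
by rewrite /Linfty_dist Lnorm.unlock/= mu_gt0.
Qed.

Lemma Linfty_dist_xx (R : realType) (T0 : R) (f : R -> R) :
  Linfty_dist T0 f f = 0%E.
Proof.
rewrite /Linfty_dist (_ : _ \o _ = cst 0%E) ?Lnorm0//.
by apply/funext => t /=; rewrite patchE/= subrr; case: ifP.
Qed.

Lemma Linfty_distC (R : realType) (T0 : R) (f g : R -> R) :
  Linfty_dist T0 f g = Linfty_dist T0 g f.
Proof.
rewrite !Linfty_distE; congr ess_sup; apply/funext => t /=.
by rewrite !patchE/=; case: ifP => // _; rewrite distrC.
Qed.

Lemma Linfty_dist_triangle (R : realType) (T0 : R) (f g h : R -> R) :
  (Linfty_dist T0 f h <= Linfty_dist T0 f g + Linfty_dist T0 g h)%E.
Proof.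
rewrite !Linfty_distE; apply: le_trans; last exact: ess_sup_absD.
apply: le_ess_sup; apply: nearW => t /=; rewrite !patchE/= lee_fin.
by case: ifP => _; rewrite ?addr0// addrA subrK.
Qed.

(* Elements of PS that coincide on [0, T0] are at distance 0, so PS carries a
   pseudometric whose metric quotient is the space of coefficients on [0, T0]. *)
Definition PS_ball (R : realType) (T0 mu1 mu2 : R) (omega theta : R -> R)
    (c : PS T0 mu1 mu2 omega theta) (e : R) : set (PS T0 mu1 mu2 omega theta) :=
  [set d | (Linfty_dist T0 c d < e%:E)%E].

Lemma PS_ball_center (R : realType) (T0 mu1 mu2 : R) (omega theta : R -> R)
    (c : PS T0 mu1 mu2 omega theta) (e : R) : 0 < e -> PS_ball c e c.
Proof. by move=> e0; rewrite /PS_ball/= Linfty_dist_xx. Qed.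

Lemma PS_ball_sym (R : realType) (T0 mu1 mu2 : R) (omega theta : R -> R)
    (c d : PS T0 mu1 mu2 omega theta) (e : R) : PS_ball c e d -> PS_ball d e c.
Proof. by rewrite /PS_ball/= Linfty_distC. Qed.

Lemma PS_ball_triangle (R : realType) (T0 mu1 mu2 : R) (omega theta : R -> R)
    (c d f : PS T0 mu1 mu2 omega theta) (e1 e2 : R) :
  PS_ball c e1 d -> PS_ball d e2 f -> PS_ball c (e1 + e2) f.
Proof.
rewrite /PS_ball/= => cd df; apply: (le_lt_trans (Linfty_dist_triangle _ _ d _)).
by rewrite EFinD lteD.
Qed.

HB.instance Definition _ (R : realType) (T0 mu1 mu2 : R) (omega theta : R -> R) :=
  gen_eqMixin (PS T0 mu1 mu2 omega theta).
HB.instance Definition _ (R : realType) (T0 mu1 mu2 : R) (omega theta : R -> R) :=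
  gen_choiceMixin (PS T0 mu1 mu2 omega theta).
HB.instance Definition _ (R : realType) (T0 mu1 mu2 : R) (omega theta : R -> R) :=
  hasNbhs.Build (PS T0 mu1 mu2 omega theta)
    (nbhs_ (entourage_ (@PS_ball R T0 mu1 mu2 omega theta))).
HB.instance Definition _ (R : realType) (T0 mu1 mu2 : R) (omega theta : R -> R) :=
  @Nbhs_isPseudoMetric.Build R (PS T0 mu1 mu2 omega theta)
    (entourage_ (@PS_ball R T0 mu1 mu2 omega theta)) erefl
    (@PS_ball R T0 mu1 mu2 omega theta)
    (@PS_ball_center R T0 mu1 mu2 omega theta)
    (@PS_ball_sym R T0 mu1 mu2 omega theta)
    (@PS_ball_triangle R T0 mu1 mu2 omega theta) erefl.

Definition residual (X : topologicalType) (S : set X) : Prop :=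
  exists2 U : nat -> set X, forall n, open (U n) /\ dense (U n) &
    \bigcap_n U n `<=` S.

Definition m_cost (R : realType) (T0 : R) (omega theta : R -> R)
    (lambda s : R) : \bar R :=
  ((lambda * omega (1 / lambda) * s)%:E +
   \int[lebesgue_measure]_(t in `]s, T0[) (theta t)%:E)%E.

(* The infimum is a finite minimum, see m_lambdaP. *)
Definition m_lambda (R : realType) (T0 : R) (omega theta : R -> R)
    (lambda : R) : R :=
  fine (ereal_inf [set m_cost T0 omega theta lambda s | s in `[0, T0]]).

Lemma m_lambdaP (R : realType) (T0 : R) (omega theta : R -> R) (lambda : R) :
  0 < T0 -> modulus_of_continuity omega ->
  {in `]0, T0[, forall t, 0 < theta t} ->
  {in `]0, T0[, continuous theta} ->
  {in `]0, T0[ &, {homo theta : x y /~ x <= y}} ->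
  0 < lambda ->
  exists2 s, s \in `[0, T0] &
    m_cost T0 omega theta lambda s = (m_lambda T0 omega theta lambda)%:E /\
    {in `[0, T0], forall r,
      ((m_lambda T0 omega theta lambda)%:E <= m_cost T0 omega theta lambda r)%E}.
Proof.
move=> T0_gt0 omegaP theta_gt0 theta_cont theta_noninc lambda_gt0.
set k := lambda * omega (1 / lambda).
have k_gt0 : 0 < k by rewrite mulr_gt0// (modulus_gt0 omegaP)// divr_gt0.
have [s [s_ge0 sT0 le_s gt_s]] : exists s : R, [/\ 0 <= s, s <= T0,
    forall t : R, 0 < t < T0 -> t < s -> k <= theta t &
    forall t : R, 0 < t < T0 -> s < t -> theta t <= k].
  pose A := [set t | 0 < t < T0 /\ k <= theta t].
  have [A0|/set0P[a Aa]] := eqVneq A set0.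
    exists 0; split => // [|t /andP[t0 _]|t tT0 _]; first exact: ltW.
      by rewrite ltNge (ltW t0).
    rewrite leNgt; apply/negP => /ltW kt.
    by have : A t by []; rewrite A0.
  have supA : has_sup A.
    by split; [exists a | exists T0 => t [/andP[_ /ltW]]].
  have [/andP[a0 aT0] _] := Aa.
  exists (sup A); split.
  - by apply: (le_trans (ltW a0)); apply: ub_le_sup => //; exact: supA.2.
  - by apply: ge_sup; [exists a | move=> t [/andP[_ /ltW]]].
  - move=> t /andP[t0 tT0] ts.
    have [r [/andP[r0 rT0] kr]] : exists2 r, A r & t < r.
      have := sup_adherent (_ : 0 < sup A - t) supA; rewrite subr_gt0 subKr.
      by apply.
    move=> /ltW tr; rewrite (le_trans kr)// theta_noninc// in_itv/=.
      by rewrite r0.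
    by rewrite t0.
  - move=> t tT0 st; rewrite leNgt; apply/negP => /ltW kt.
    by move: st; rewrite ltNge ub_le_sup//; exact: supA.2.
pose mu := @lebesgue_measure R.
have sub (r : R) : 0 <= r -> `]r, T0[%classic `<=` `]0, T0[%classic.
  by move=> r0 x /=; rewrite !in_itv/= => /andP[/(le_lt_trans r0)-> ->].
have mtheta (D : set R) : D `<=` `]0, T0[%classic ->
    measurable_fun D (EFin \o theta).
  move=> D0; apply/measurable_EFinP; apply: (measurable_funS _ D0) => //.
  apply: open_continuous_measurable_fun; first exact: interval_open.
  by move=> x; rewrite inE/= => /theta_cont.
have theta0 (D : set R) : D `<=` `]0, T0[%classic ->
    forall x, D x -> (0 <= (theta x)%:E)%E.
  by move=> D0 x /D0 /theta_gt0/ltW; rewrite lee_fin.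
have bnd (D : set R) (l : R) : measurable D -> D `<=` `]s, T0[%classic ->
    (mu D <= l%:E)%E -> (\int[mu]_(t in D) (theta t)%:E <= (k * l)%:E)%E.
  move=> mD Ds Dl.
  have D0 : D `<=` `]0, T0[%classic by apply: (subset_trans Ds); exact: sub.
  apply: (@le_trans _ _ (\int[mu]_(t in D) (cst k%:E t))%E).
    apply: ge0_le_integral => //; first exact: theta0.
      exact: mtheta.
    move=> x Dx; rewrite lee_fin gt_s//.
      by have := D0 _ Dx; rewrite /= in_itv.
    by have := Ds _ Dx; rewrite /= in_itv => /andP[].
  rewrite integral_cst// (EFinM k l); apply: lee_wpmul2l => //.
  by rewrite lee_fin ltW.
have itvoo (x y : R) : x <= y -> mu `]x, y[%classic = (y - x)%:E.
  rewrite le_eqVlt /mu lebesgue_measure_itv/= lte_fin => /predU1P[->|->//].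
  by rewrite ltxx subrr.
have itvoc (x y : R) : x <= y -> mu `]x, y]%classic = (y - x)%:E.
  rewrite le_eqVlt /mu lebesgue_measure_itv/= lte_fin => /predU1P[->|->//].
  by rewrite ltxx subrr.
have cost_min : {in `[0, T0], forall r,
    (m_cost T0 omega theta lambda s <= m_cost T0 omega theta lambda r)%E}.
  move=> r; rewrite in_itv/= => /andP[r0 rT0]; rewrite /m_cost -/k -/mu.
  have [rs|sr|->//] := ltgtP r s.
    have -> : k * s = k * r + k * (s - r) by rewrite -mulrDr addrC subrK.
    rewrite EFinD -addeA leeD2l//.
    apply: (@le_trans _ _ (\int[mu]_(t in `]r, s[ `|` `]s, T0[) (theta t)%:E)%E).
      have US : `]r, s[%classic `|` `]s, T0[%classic `<=` `]0, T0[%classic.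
        move=> x /= [|]; rewrite !in_itv/= => /andP[x0 xT].
          by rewrite (le_lt_trans r0 x0) (lt_le_trans xT sT0).
        by rewrite (le_lt_trans s_ge0 x0).
      rewrite ge0_integral_setU//.
      - rewrite leeD2r//.
        apply: (@le_trans _ _ (\int[mu]_(t in `]r, s[) (cst k%:E t))%E).
          rewrite integral_cst// (EFinM k) -itvoo; [exact: lexx|exact: ltW].
        have rsT : `]r, s[%classic `<=` `]0, T0[%classic.
          by move=> x xrs; apply: US; left.
        apply: ge0_le_integral => //.
        - by move=> x _; rewrite lee_fin ltW.
        - exact: mtheta.
        - move=> x xrs; rewrite lee_fin le_s//.
            by have := rsT _ xrs; rewrite /= in_itv.
          by move: xrs; rewrite /= in_itv => /andP[].
      - exact: mtheta.
      - exact: theta0.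
      - rewrite disj_set2E; apply/eqP; rewrite -subset0 => x [] /=.
        rewrite !in_itv/= => /andP[_ xs] /andP[sx _].
        by move: (lt_trans xs sx); rewrite ltxx.
    apply: ge0_subset_integral => //.
    - by apply: measurableU.
    - by apply: mtheta; exact: sub.
    - by apply: theta0; exact: sub.
    - move=> x /= [|]; rewrite !in_itv/= => /andP[x0 xT].
        by rewrite x0 (lt_le_trans xT sT0).
      by rewrite (lt_trans rs x0).
  have -> : k * r = k * s + k * (r - s) by rewrite -mulrDr addrC subrK.
  rewrite EFinD -addeA leeD2l//.
  move: rT0; rewrite le_eqVlt => /predU1P[->|rT0].
    rewrite (_ : `]T0, T0[%classic = set0) ; last exact: set_itvoo0.
    rewrite integral_set0 adde0.
    by apply: bnd => //; rewrite itvoo.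
  have E : `]s, T0[%classic = `]s, r]%classic `|` `]r, T0[%classic.
    by rewrite -(@itv_bndbnd_setU _ _ _ (BRight r))// bnd_simp ltW.
  rewrite {1}E ge0_integral_setU//.
  - rewrite leeD2r//; apply: bnd => //; last by rewrite itvoc// ltW.
    by rewrite E; exact: subsetUl.
  - by rewrite -E; apply: mtheta; exact: sub.
  - by rewrite -E; apply: theta0; exact: sub.
  - rewrite disj_set2E; apply/eqP; rewrite -subset0 => x [] /=.
    rewrite !in_itv/= => /andP[_ xs] /andP[sx _].
    by move: (le_lt_trans xs sx); rewrite ltxx.
have cost_ge0 : (0 <= m_cost T0 omega theta lambda s)%E.
  rewrite /m_cost -/k adde_ge0//; first by rewrite lee_fin mulr_ge0// ltW.
  by apply: integral_ge0; apply: theta0; exact: sub.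
have cost_fin : m_cost T0 omega theta lambda s \is a fin_num.
  rewrite ge0_fin_numE//; apply: (le_lt_trans (cost_min T0 _)).
    by rewrite in_itv/= lexx ltW.
  rewrite /m_cost (_ : `]T0, T0[%classic = set0) ; last exact: set_itvoo0.
  by rewrite integral_set0 adde0 ltry.
have s_in : s \in `[0, T0] by rewrite in_itv/= s_ge0.
have mE : (m_lambda T0 omega theta lambda)%:E = m_cost T0 omega theta lambda s.
  rewrite /m_lambda (_ : ereal_inf _ = m_cost T0 omega theta lambda s) ?fineK//.
  apply/eqP; rewrite eq_le; apply/andP; split.
    by apply: ereal_inf_lbound; exists s.
  by apply: le_ereal_inf_tmp => _ [r /= r_in <-]; exact: cost_min.
exists s => //; split; first by rewrite mE.
by move=> r r_in; rewrite mE; exact: cost_min.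
Qed.

(* Derivative on the closed interval [a, b], one-sided at the endpoints. *)
Definition derivative_on (R : realType) (a b : R) (f f' : R -> R) : Prop :=
  {in `[a, b], forall t,
    (f s - f t) / (s - t) @[s --> within `[a, b] t^'] --> f' t}.

(* u solves u'' + lambda^2 c u = 0 on [0, T0] and u' is its derivative. *)
Definition solves (R : realType) (T0 lambda : R) (c u u' : R -> R) : Prop :=
  derivative_on 0 T0 u u' /\
  exists2 u'' : R -> R, derivative_on 0 T0 u' u'' &
    {in `[0, T0], forall t, u'' t + lambda ^+ 2 * c t * u t = 0}.

(* Main.v *)
Require Import Defs.
From mathcomp Require Import all_boot all_order all_algebra.
From mathcomp Require Import all_classical all_reals all_analysis.
From mathcomp Require Import ess_sup_inf measurable_realfun.
From mathcomp Require Import ring lra.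

(* Let E = u'^2 + lambda^2 u^2. For any C^1 function d close to c, the derivative
   of F = u'^2 + lambda^2 d u^2 is at most
   (lambda |d - c| / sqrt mu1 + |d'| / mu1) F, so Gronwall bounds the growth of E.
   With d the average of c over a window of length 1 / lambda both terms cost
   lambda omega(1 / lambda) per unit time; with shorter and shorter windows the
   cost is theta / mu1, because the bound on the weak derivative makes c locally
   Lipschitz. Using the first bound on [0, s] and the second on [s, T0], with s
   optimal, gives (1).

   For (2), membership in the set only has to be checked on countably many
   interiors of sets of coefficients for which some u_{lambda_n}, n >= k, grows
   on [1/(k+1), T0]. For density, move a coefficient slightly away from its
   constraints, regularize it and make it equal to a constant gamma^2 near 0;
   there, superpose an oscillation in resonance with sin (gamma lambda t), whose
   amplitude on each half period is a small multiple of
   min (lambda omega (1 / lambda), theta) / lambda. This makes an explicit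
   solution grow like the exponential of a Riemann sum that dominates a multiple
   of m(lambda), up to a constant independent of lambda. Past the oscillation,
   the reversed energy estimate loses only a bounded factor, and everything
   survives a small perturbation of the coefficient. *)

(** Concentrating the oscillation near 0 costs only a bounded amount: [theta] is nonincreasing, so
    its integral away from 0 is at most a constant independent of lambda, whereas m(lambda) tends to
    infinity in (2). The coefficient is made constant there because a vanishing derivative leaves
    all of [theta] to the oscillation, and moving it towards the centre of [mu1, mu2] creates the
    slack [eta] in the bounds and in the modulus that the oscillation spends.

    The constants fit as follows. The mean of sin^4 is 3/8, so the squared amplitude has exponent
    3/4 kap m(lambda) up to a constant; [kap] is at least 4 M3, so this is at least 3 M3 m(lambda),
    of which 2 M3 m(lambda) pays for all losses independent of lambda.

    Every solution for a nearby coefficient is compared directly with the explicit one. The radius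
    of admissible perturbations may depend on lambda in any way, because it is chosen last; this is
    what allows crude constants in that comparison. *)

Set Implicit Arguments.
Unset Strict Implicit.
Unset Printing Implicit Defensive.

Import Order.TTheory GRing.Theory Num.Theory.
Import numFieldNormedType.Exports.

Local Open Scope classical_set_scope.
Local Open Scope ring_scope.

(** * Derivatives and Gronwall inequalities *)

(* A plain proposition, so that apply: does not trigger instance resolution on the class is_derive. *)
Definition has_deriv (R : realType) (f : R -> R) (x l : R) : Prop :=
  is_derive x (1 : R) f l.

Lemma has_derivD (R : realType) (f g : R -> R) (x df dg : R) :
  has_deriv f x df -> has_deriv g x dg ->
  has_deriv (fun y => f y + g y) x (df + dg).
Proof. by move=> hf hg; exact: is_deriveD. Qed.

Lemma has_derivB (R : realType) (f g : R -> R) (x df dg : R) :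
  has_deriv f x df -> has_deriv g x dg ->
  has_deriv (fun y => f y - g y) x (df - dg).
Proof. by move=> hf hg; exact: is_deriveB. Qed.

Lemma has_derivM (R : realType) (f g : R -> R) (x df dg : R) :
  has_deriv f x df -> has_deriv g x dg ->
  has_deriv (fun y => f y * g y) x (df * g x + f x * dg).
Proof.
move=> hf hg; apply: (is_derive_eq (is_deriveM hf hg)).
by rewrite addrC /GRing.scale/= mulrC.
Qed.

Lemma has_derivZ (R : realType) (f : R -> R) (k x df : R) :
  has_deriv f x df -> has_deriv (fun y => k * f y) x (k * df).
Proof. by move=> hf; exact: is_deriveZ. Qed.

Lemma has_derivX (R : realType) (f : R -> R) (n : nat) (x df : R) :
  has_deriv f x df ->
  has_deriv (fun y => f y ^+ n) x (n%:R * f x ^+ n.-1 * df).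
Proof.
move=> hf; have h := @is_deriveX _ _ f n x 1 df hf.
by move: h; rewrite (_ : f ^+ n = (fun y => f y ^+ n))//; apply/funext => y; rewrite fctE.
Qed.

Lemma has_deriv_comp (R : realType) (f g : R -> R) (x df dg : R) :
  has_deriv f (g x) df -> has_deriv g x dg ->
  has_deriv (fun y => f (g y)) x (df * dg).
Proof. by move=> hf hg; exact: is_derive1_comp. Qed.

Lemma has_derivN (R : realType) (f : R -> R) (x df : R) :
  has_deriv f x df -> has_deriv (fun y => - f y) x (- df).
Proof. by move=> hf; exact: is_deriveN. Qed.

Lemma has_deriv_expR (R : realType) (f : R -> R) (x df : R) :
  has_deriv f x df ->
  has_deriv (fun y => expR (f y)) x (expR (f x) * df).
Proof. by move=> hf; apply: (@has_deriv_comp R expR f) => //; exact: is_derive_expR. Qed.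

Lemma has_deriv_scale (R : realType) (k x : R) : has_deriv (fun y => k * y) x k.
Proof. by rewrite -[X in has_deriv _ _ X]mulr1; apply: has_derivZ; exact: is_derive_id. Qed.

Lemma has_deriv_sin (R : realType) (k x : R) :
  has_deriv (fun y => sin (k * y)) x (cos (k * x) * k).
Proof.
apply: (@has_deriv_comp R sin (fun y => k * y)); first exact: is_derive_sin.
exact: has_deriv_scale.
Qed.

Lemma has_deriv_cos (R : realType) (k x : R) :
  has_deriv (fun y => cos (k * y)) x (- sin (k * x) * k).
Proof.
apply: (@has_deriv_comp R cos (fun y => k * y)); first exact: is_derive_cos.
exact: has_deriv_scale.
Qed.

Lemma has_deriv_continuous_at (R : realType) (f : R -> R) (x df : R) :
  has_deriv f x df -> {for x, continuous f}.
Proof. by case=> /derivable1_diffP/differentiable_continuous. Qed.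

Lemma has_deriv_continuous (R : realType) (f f' : R -> R) :
  (forall x : R, has_deriv f x (f' x)) -> continuous f.
Proof. by move=> h x; exact: has_deriv_continuous_at (h x). Qed.

Lemma MVT_le (R : realType) (f df : R -> R) (a b : R) : a <= b ->
  (forall x, x \in `]a, b[ -> has_deriv f x (df x)) ->
  {within `[a, b], continuous f} ->
  (forall x, x \in `]a, b[ -> df x <= 0) -> f b <= f a.
Proof.
rewrite le_eqVlt => /predU1P[-> //|ab] hf cf h.
have [c cab] := MVT ab hf cf.
move=> /eqP; rewrite subr_eq => /eqP ->.
by rewrite gerDr mulr_le0_ge0 ?h// subr_ge0 ltW.
Qed.

Lemma within_continuousM_fun (R : realType) (A : set R) (f g : R -> R) :
  {within A, continuous f} -> {within A, continuous g} ->
  {within A, continuous (fun x => f x * g x)}.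
Proof.
move=> /subspace_continuousP hf /subspace_continuousP hg.
by apply/subspace_continuousP => x Ax; apply: cvgM; [exact: hf|exact: hg].
Qed.

Lemma within_continuousD_fun (R : realType) (A : set R) (f g : R -> R) :
  {within A, continuous f} -> {within A, continuous g} ->
  {within A, continuous (fun x => f x + g x)}.
Proof.
move=> /subspace_continuousP hf /subspace_continuousP hg.
by apply/subspace_continuousP => x Ax; apply: cvgD; [exact: hf|exact: hg].
Qed.

Lemma gronwall (R : realType) (F F' K k : R -> R) (a b : R) : a <= b ->
  (forall x, x \in `]a, b[ -> has_deriv F x (F' x)) ->
  {within `[a, b], continuous F} ->
  (forall x, has_deriv K x (k x)) ->
  (forall x, x \in `]a, b[ -> F' x <= k x * F x) ->
  F b <= F a * expR (K b - K a).
Proof.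
move=> ab hF cF hK h.
have cK : continuous K by exact: has_deriv_continuous hK.
have hG x : x \in `]a, b[ -> has_deriv (fun y => F y * expR (- K y)) x
    (F' x * expR (- K x) + F x * (expR (- K x) * - k x)).
  move=> xab; apply: has_derivM; first exact: hF.
  by apply: has_deriv_expR; exact: has_derivN.
have : F b * expR (- K b) <= F a * expR (- K a).
  apply: (MVT_le ab hG).
    apply: within_continuousM_fun => //; apply: continuous_subspaceT => y.
    apply: (@continuous_comp _ _ _ (fun y => - K y) expR); last exact: continuous_expR.
    by apply: continuousN; exact: cK.
  move=> x xab; have e0 := expR_gt0 (- K x).
  have := h _ xab; nra.
rewrite -(ler_pM2r (expR_gt0 (K b))) -!mulrA -!expRD addNr expR0 mulr1.
by rewrite addrC.
Qed.

Lemma has_deriv_eps (R : realType) (f : R -> R) (x l : R) :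
  (forall e : R, 0 < e -> exists2 d : R, 0 < d &
    forall y, y != x -> `|y - x| < d -> `|(f y - f x) / (y - x) - l| <= e) ->
  has_deriv f x l.
Proof.
move=> h.
have H : h^-1 *: ((f \o shift x) (h *: (1 : R)) - f x) @[h --> 0^'] --> l.
  apply/cvgrPdist_le => e /h[d d0 {}h].
  rewrite near_withinE; apply/nbhs_ballP; exists d => // y.
  rewrite /ball/= sub0r normrN => yd y0.
  have := h (y + x); rewrite addrK distrC.
  have -> : (y + x == x) = (y == 0) by rewrite -subr_eq0 addrK.
  by rewrite /= [y *: _]mulr1 mulrC; apply.
split; last exact: cvg_lim.
by apply/cvg_ex; exists l.
Qed.

Lemma derivative_on_eps (R : realType) (a b : R) (f f' : R -> R) (t : R) :
  derivative_on a b f f' -> t \in `[a, b] ->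
  forall e : R, 0 < e -> exists2 d : R, 0 < d &
    forall y, y \in `[a, b] -> y != t -> `|y - t| < d ->
      `|(f y - f t) / (y - t) - f' t| <= e.
Proof.
move=> /[apply] /cvgrPdist_le h e /h.
rewrite near_withinE near_withinE => /nbhs_ballP[d /= d0 H].
exists d => // y yab yt yd; rewrite distrC; apply: H => //.
by rewrite /ball/= distrC.
Qed.

Lemma derivative_on_has_deriv (R : realType) (a b : R) (f f' : R -> R) (t : R) :
  derivative_on a b f f' -> t \in `]a, b[ -> has_deriv f t (f' t).
Proof.
move=> hf tab; apply: has_deriv_eps => e e0.
have [d d0 h] := derivative_on_eps hf (subset_itv_oo_cc tab) e0.
move: tab; rewrite in_itv/= => /andP[at_ tb].
exists (Num.min d (Num.min (t - a) (b - t))).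
  by rewrite !lt_min d0 !subr_gt0 at_.
move=> y yt; rewrite !lt_min => /and3P[yd ya yb]; apply: h => //.
by rewrite in_itv/=; move: ya yb; rewrite !ltr_norml; lra.
Qed.

Lemma continuous_within_eps (R : realType) (A : set R) (f : R -> R) :
  (forall x e : R, A x -> 0 < e -> exists2 d : R, 0 < d &
    forall y, A y -> `|y - x| < d -> `|f y - f x| <= e) ->
  {within A, continuous f}.
Proof.
move=> h; apply/subspace_continuousP => x Ax.
apply/cvgrPdist_le => e /(h x e Ax)[d d0 H].
rewrite near_withinE; apply/nbhs_ballP; exists d => // y /= yd Ay.
by rewrite distrC; apply: H => //; rewrite distrC.
Qed.

Lemma within_continuous_eps (R : realType) (A : set R) (f : R -> R) :
  {within A, continuous f} ->
  forall x e : R, A x -> 0 < e -> exists2 d : R, 0 < d &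
    forall y, A y -> `|y - x| < d -> `|f y - f x| <= e.
Proof.
move=> /subspace_continuousP h x e Ax e0.
have /cvgrPdist_le/(_ e e0) := h x Ax.
rewrite near_withinE => /nbhs_ballP[d /= d0 H].
by exists d => // y Ay yd; rewrite distrC; apply: H => //; rewrite /ball/= distrC.
Qed.

Lemma derivative_on_continuous (R : realType) (a b : R) (f f' : R -> R) :
  derivative_on a b f f' -> {within `[a, b], continuous f}.
Proof.
move=> hf; apply: continuous_within_eps => x e xab e0.
have [d d0 h] := derivative_on_eps hf xab ltr01.
pose M := `|f' x| + 1.
have M0 : 0 < M by rewrite ltr_wpDl.
exists (Num.min d (e / M)); first by rewrite lt_min d0 divr_gt0.
move=> y yab; rewrite lt_min => /andP[yd ye].
have [->|yx] := eqVneq y x; first by rewrite subrr normr0 ltW.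
have yx0 : y - x != 0 by rewrite subr_eq0.
have H := h _ yab yx yd.
have {}H : `|(f y - f x) / (y - x)| <= M.
  rewrite -[X in `|X|](subrK (f' x)); apply: (le_trans (ler_normD _ _)).
  by rewrite addrC lerD2l.
rewrite -(divfK yx0 (f y - f x)) normrM.
apply: (le_trans (ler_wpM2r _ H)) => //.
by rewrite mulrC -ler_pdivlMr// ltW.
Qed.

(** Brings estimates between an earlier and a later interior time to the endpoints, where [theta]
    may blow up; two functions are compared because the two energies carry different factors. *)
Lemma within_le (R : realType) (f g : R -> R) (a b : R) : a < b ->
  {within `[a, b], continuous f} -> {within `[a, b], continuous g} ->
  (forall x y, a < x -> x < y -> y < b -> f y <= g x) -> f b <= g a.
Proof.
move=> ab cf cg h; apply/ler_addgt0Pr => e e0.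
have e20 : 0 < e / 2 by rewrite divr_gt0.
have bab : `[a, b]%classic b by rewrite /= in_itv/= lexx ltW.
have aab : `[a, b]%classic a by rewrite /= in_itv/= lexx ltW.
have [d d0 hd] := within_continuous_eps cf bab e20.
have [d' d'0 hd'] := within_continuous_eps cg aab e20.
(* A third of the length keeps [a + r] strictly to the left of [b - r]. *)
pose r := Num.min (Num.min d d') (b - a) / 3.
have r0 : 0 < r by rewrite divr_gt0// !lt_min d0 d'0 subr_gt0.
have [rd rd' rab] : [/\ r < d, r < d' & r * 3 <= b - a].
  have rd : r * 3 <= Num.min d d' by rewrite divfK// ge_min lexx.
  have rb : r * 3 <= b - a by rewrite divfK// ge_min lexx orbT.
  move: rd; rewrite le_min => /andP[? ?]; split => //; lra.
have := h (a + r) (b - r).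
have := hd (b - r); have := hd' (a + r); rewrite /= !in_itv/=.
have -> : a + r - a = r by ring.
have -> : b - r - b = - r by ring.
rewrite normrN gtr0_norm//.
move=> /(_ ltac:(lra) rd') h1 /(_ ltac:(lra) rd) h2 /(_ ltac:(lra) ltac:(lra) ltac:(lra)).
by move: h1 h2; rewrite !ler_norml; lra.
Qed.

(** * Antiderivatives and moving averages *)

Lemma has_deriv_near (R : realType) (f g : R -> R) (x l d : R) : 0 < d ->
  (forall y, `|y - x| < d -> f y = g y) -> has_deriv f x l -> has_deriv g x l.
Proof.
move=> d0 fg; apply: near_eq_is_derive.
by apply/nbhs_ballP; exists d => // y yd; apply: fg; rewrite distrC.
Qed.

Lemma MVT_deriv (R : realType) (f df : R -> R) (a b : R) : a <= b ->
  (forall x, x \in `[a, b] -> has_deriv f x (df x)) ->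
  exists2 c, c \in `[a, b] & f b - f a = df c * (b - a).
Proof.
move=> ab hf; apply: MVT_segment => //.
  by move=> x xab; apply: hf; exact: subset_itv_oo_cc.
by move=> x; apply: continuous_in_subspaceT => y; rewrite inE => /hf /has_deriv_continuous_at.
Qed.

Lemma deriv0_cst (R : realType) (f : R -> R) (a b : R) :
  (forall x, (a <= x <= b) || (b <= x <= a) -> has_deriv f x 0) -> f a = f b.
Proof.
wlog ab : a b / a <= b => [wh|] h.
  have [|/ltW] := leP a b => ab; first exact: wh.
  by symmetry; apply: wh => // x; rewrite orbC => ?; exact: h.
have [|c _ /eqP] := @MVT_deriv _ f (cst 0) a b ab.
  by move=> x; rewrite in_itv/= => xab; apply: h; rewrite xab.
by rewrite mul0r subr_eq0 => /eqP.
Qed.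

(** The integral from a base point [a] is a primitive only to the right of [a]. Normalized to vanish
    at 0, the primitives from two negative base points agree where both are valid, so a base point
    that moves with [x] glues them into one primitive on the whole line. *)
Lemma antiderivative (R : realType) (f : R -> R) : continuous f ->
  exists F : R -> R, forall x, has_deriv F x (f x).
Proof.
move=> cf.
pose G (a : R) x := \int[lebesgue_measure]_(t in `[a, x]) f t.
have hG (a x : R) : a < x -> has_deriv (G a) x (f x).
  move=> ax; have x1 : x < x + 1 by rewrite ltrDl.
  have fi : (@lebesgue_measure R).-integrable `[a, x + 1] (EFin \o f).
    apply: continuous_compact_integrable; first exact: segment_compact.
    exact: continuous_subspaceT.
  have [dG <-] := continuous_FTC1_closed x1 fi ax (cf x).
  by rewrite derive1E; exact/derivableP.
pose H (a x : R) := G a x - G a 0.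
have hH (a x : R) : a < x -> has_deriv (H a) x (f x).
  move=> /hG h; rewrite -[f x]subr0; apply: has_derivB => //; exact: is_derive_cst.
have HE (a a' x : R) : a < 0 -> a' < 0 -> a < x -> a' < x -> H a x = H a' x.
  move=> a0 a'0 ax a'x; apply/eqP; rewrite -subr_eq0; apply/eqP.
  have <- : H a 0 - H a' 0 = H a x - H a' x.
    apply: (@deriv0_cst _ (fun y => H a y - H a' y)) => y yx.
    rewrite -(subrr (f y)).
    by apply: has_derivB; apply: hH; case/orP: yx => /andP[]; lra.
  by rewrite /H !subrr.
exists (fun x => H (- (`|x| + 1)) x) => x.
have := ler_norm x; have := ler_norm (- x); rewrite normrN => nx1 nx2.
have nx0 := normr_ge0 x.
(* For [y] within 1 of [x] the moving base point stays to the right of this fixed one. *)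
apply: (@has_deriv_near _ (H (- (`|x| + 3)))  _ _ _ 1) => //.
  move=> y; rewrite ltr_norml => yx.
  by have := ler_norm y; have := ler_norm (- y); rewrite normrN => *; apply: HE; lra.
by apply: hH; lra.
Qed.

(* The mean value theorem replaces every integral estimate on the average. *)
Lemma mollify (R : realType) (f : R -> R) (e : R) : 0 < e -> continuous f ->
  exists g : R -> R, [/\ forall x, has_deriv g x ((f (x + e) - f x) / e),
    forall x, exists2 y, y \in `[x, x + e] & g x = f y &
    forall x y, exists r, g x - g y = f (x + r) - f (y + r)].
Proof.
move=> e0 cf; have [F hF] := antiderivative cf.
have hs r x : has_deriv (fun y => F (y + r)) x (f (x + r)).
  rewrite -[f (x + r)]mulr1; apply: (@has_deriv_comp _ F (fun y => y + r)); first exact: hF.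
  rewrite -[X in has_deriv _ _ X]addr0.
  by apply: has_derivD; [exact: is_derive_id|exact: is_derive_cst].
exists (fun x => e^-1 * (F (x + e) - F x)); split=> [x|x|x y].
- rewrite mulrC; apply: has_derivZ; apply: has_derivB; first exact: hs.
  exact: hF.
- have [||c cx ->] := @MVT_deriv _ F f x (x + e); first by rewrite lerDl ltW.
    by move=> y _; exact: hF.
  by exists c => //; rewrite addrAC subrr add0r mulrCA mulVf ?mulr1// gt_eqF.
(* Applying the mean value theorem to the difference yields one shift for both points, so every
   modulus of continuity of [f] passes to [g]. *)
- have hr r : has_deriv (fun r => F (x + r) - F (y + r)) r (f (x + r) - f (y + r)).
    rewrite [x + r]addrC [y + r]addrC.
    by under eq_fun do rewrite [x + _]addrC [y + _]addrC; apply: has_derivB; exact: hs.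
  have [c _ ] := @MVT_deriv _ _ _ 0 e (ltW e0) (fun r _ => hr r).
  rewrite !addr0 subr0 => h; exists c; rewrite -mulrBr.
  rewrite (_ : _ - _ - _ = F (x + e) - F (y + e) - (F x - F y)); last by ring.
  by rewrite h mulrCA mulVf ?mulr1// gt_eqF.
Qed.

(** Composing with this projection extends a function from [[a, b]] to the line by its endpoint
    values, so that averages may look past the ends. *)
Definition clamp (R : realType) (a b x : R) : R := Num.min (Num.max x a) b.

Lemma clamp_itv (R : realType) (a b x : R) : a <= b -> a <= clamp a b x <= b.
Proof.
by move=> ab; rewrite /clamp le_min ab le_max lexx orbT ge_min lexx orbT.
Qed.

Lemma clamp_id (R : realType) (a b x : R) : a <= x <= b -> clamp a b x = x.
Proof. by move=> /andP[ax xb]; rewrite /clamp max_l// min_l. Qed.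

Lemma clamp_homo (R : realType) (a b x y : R) : x <= y ->
  clamp a b x <= clamp a b y.
Proof.
by move=> xy; rewrite /clamp/Num.min/Num.max; do !case: ifPn; rewrite -?leNgt; lra.
Qed.

Lemma clamp_lip (R : realType) (a b x y : R) : a <= b ->
  `|clamp a b x - clamp a b y| <= `|x - y|.
Proof.
move=> ab; wlog xy : x y / x <= y => [wh|].
  have [/wh//|/ltW/wh] := leP x y.
  by rewrite distrC [`|y - x|]distrC.
have := clamp_homo a b xy; rewrite -subr_ge0 distrC => h; rewrite ger0_norm//.
rewrite distrC ger0_norm ?subr_ge0//; move: h.
by rewrite /clamp/Num.min/Num.max; do !case: ifPn; rewrite -?leNgt; lra.
Qed.

Lemma continuous_clamp (R : realType) (f : R -> R) (a b : R) : a <= b ->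
  {within `[a, b], continuous f} -> continuous (fun x => f (clamp a b x)).
Proof.
move=> ab cf x; apply/cvgrPdist_le => e e0.
have [|d d0 h] := @within_continuous_eps _ _ _ cf (clamp a b x) e _ e0.
  by rewrite /= in_itv/= clamp_itv.
apply/nbhs_ballP; exists d => //= y yd; rewrite distrC; apply: h.
  by rewrite /= in_itv/= clamp_itv.
by apply: (le_lt_trans (clamp_lip _ _ ab)); rewrite distrC.
Qed.

(** * Energy estimates *)

(** [gronwall] holds for functions of any sign, so it can be applied to [- F] with rate [- k]. *)
Lemma gronwall_rev (R : realType) (F F' K k : R -> R) (a b : R) : a <= b ->
  (forall x, x \in `]a, b[ -> has_deriv F x (F' x)) ->
  {within `[a, b], continuous F} ->
  (forall x, has_deriv K x (k x)) ->
  (forall x, x \in `]a, b[ -> - (k x * F x) <= F' x) ->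
  F a <= F b * expR (K b - K a).
Proof.
move=> ab hF cF hK h.
have hN x : x \in `]a, b[ -> has_deriv (fun x => - F x) x (- F' x).
  by move=> xab; apply: has_derivN; exact: hF.
have hKN x : has_deriv (fun x => - K x) x (- k x) by exact: has_derivN.
have cN : {within `[a, b], continuous (fun x => - F x)}.
  move: cF => /subspace_continuousP cF.
  by apply/subspace_continuousP => x Ax; apply: cvgN; exact: cF.
have hle x : x \in `]a, b[ -> - F' x <= - k x * - F x.
  by move=> xab; rewrite mulrNN -lerN2 opprK; exact: h.
have := gronwall ab hN cN hKN hle.
have -> : - K b - - K a = - (K b - K a) by ring.
by rewrite mulNr lerN2 expRN ler_pdivrMr ?expR_gt0.
Qed.

(** The left side is the derivative of the weighted energy along [u' = v], [v' = - lam ^ 2 c u]. The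
    products [u v] cancel up to the factor [d - c]; completing the square in [v] and [lam s u]
    bounds what remains by the energy. *)
Lemma energy_rate (R : realType) (lam mu eps s u v c d d' k : R) :
  0 < lam -> 0 < s -> s ^+ 2 = mu -> mu <= d -> `|d - c| <= eps -> `|d'| <= k ->
  `|v * (- (lam ^+ 2 * c * u)) *+ 2 + lam ^+ 2 * (d' * u ^+ 2 + d * (u * v *+ 2))|
  <= (lam * eps / s + k / mu) * (v ^+ 2 + lam ^+ 2 * d * u ^+ 2).
Proof.
move=> lam0 s0 smu mud hc hd.
have mu0 : 0 < mu by rewrite -smu exprn_gt0.
set F := (X in _ <= _ * X).
have u0 : 0 <= lam ^+ 2 * u ^+ 2 by rewrite mulr_ge0// sqr_ge0.
have F1 : v ^+ 2 + mu * (lam ^+ 2 * u ^+ 2) <= F.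
  by have := ler_wpM2r u0 mud; rewrite /F; lra.
have v0 := sqr_ge0 v.
have -> : v * (- (lam ^+ 2 * c * u)) *+ 2 +
    lam ^+ 2 * (d' * u ^+ 2 + d * (u * v *+ 2)) =
  lam / s * (d - c) * (lam * s * u * v *+ 2) + d' / mu * (mu * (lam ^+ 2 * u ^+ 2)).
  by field; rewrite !gt_eqF.
apply: (le_trans (ler_normD _ _)); rewrite mulrDl lerD//.
  have -> : lam * eps / s = lam / s * eps by rewrite mulrAC.
  rewrite 2!normrM ler_pM// ?mulr_ge0//.
    rewrite ger0_norm ?divr_ge0 ?(ltW lam0) ?(ltW s0)// ler_wpM2l//.
    by rewrite divr_ge0// ltW.
  apply: le_trans F1; rewrite -smu ler_norml.
  have h1 := sqr_ge0 (v - lam * s * u); have h2 := sqr_ge0 (v + lam * s * u).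
  rewrite mulr2n; apply/andP; split; nra.
rewrite normrM; apply: ler_pM => //.
  have mu'0 : 0 <= mu^-1 by rewrite invr_ge0 ltW.
  by rewrite normrM (ger0_norm mu'0); apply: ler_wpM2r.
by rewrite ger0_norm ?(mulr_ge0 (ltW mu0))//; lra.
Qed.

(** The rate is bounded in absolute value, so the energy can neither grow nor decay faster than [G]
    allows. The first half serves the upper bound, the second keeps growth alive at later times. *)
Lemma energy_gronwall (R : realType) (T0 lam mu eps a b : R)
    (c u u' d d' K k : R -> R) :
  0 < lam -> 0 < mu -> 0 <= a -> a <= b -> b <= T0 ->
  solves T0 lam c u u' ->
  (forall x, has_deriv d x (d' x)) -> (forall x, has_deriv K x (k x)) ->
  (forall x, x \in `]a, b[ -> mu <= d x) ->
  (forall x, x \in `]a, b[ -> `|d x - c x| <= eps) ->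
  (forall x, x \in `]a, b[ -> `|d' x| <= k x) ->
  let F x := u' x ^+ 2 + lam ^+ 2 * d x * u x ^+ 2 in
  let G := lam * eps / Num.sqrt mu * (b - a) + (K b - K a) / mu in
  F b <= F a * expR G /\ F a <= F b * expR G.
Proof.
move=> lam0 mu0 a0 ab bT [hu [u'' hu' hode]] hd hK mud dc d'k F G.
pose F' x := (u' x * (- (lam ^+ 2 * c x * u x))) *+ 2 +
  lam ^+ 2 * (d' x * u x ^+ 2 + d x * (u x * u' x *+ 2)).
have sub : {subset `[a, b] <= `[0, T0]}.
  by move=> x; rewrite !in_itv/= => /andP[? ?]; apply/andP; split; lra.
have subo : {subset `]a, b[ <= `]0, T0[}.
  by move=> x; rewrite !in_itv/= => /andP[? ?]; apply/andP; split; lra.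
have sc : `[a, b]%classic `<=` `[0, T0]%classic by move=> x; exact: sub.
have cu := continuous_subspaceW sc (derivative_on_continuous hu).
have cu' := continuous_subspaceW sc (derivative_on_continuous hu').
have cd : {within `[a, b], continuous d}.
  by apply: continuous_subspaceT; exact: has_deriv_continuous hd.
have hF x : x \in `]a, b[ -> has_deriv F x (F' x).
  move=> xab; have x0 := subo _ xab.
  have du := derivative_on_has_deriv hu x0; have du' := derivative_on_has_deriv hu' x0.
  have -> : F' x = 2%:R * u' x ^+ 1 * u'' x +
      (lam ^+ 2 * d' x * u x ^+ 2 + lam ^+ 2 * d x * (2%:R * u x ^+ 1 * u' x)).
    have := hode x (subset_itv_oo_cc x0) => /eqP; rewrite addr_eq0 => /eqP ->.
    by rewrite /F'; ring.
  apply: has_derivD; first exact: has_derivX.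
  by apply: has_derivM; [exact: has_derivZ|exact: has_derivX].
have cF : {within `[a, b], continuous F}.
  apply: within_continuousD_fun; first exact: (within_continuousM_fun cu' cu').
  apply: within_continuousM_fun; last exact: (within_continuousM_fun cu cu).
  apply: within_continuousM_fun => //.
  by apply: continuous_subspaceT => ?; exact: cst_continuous.
pose L x := lam * eps / Num.sqrt mu * x + mu^-1 * K x.
have hL x : has_deriv L x (lam * eps / Num.sqrt mu + mu^-1 * k x).
  apply: has_derivD; last exact: has_derivZ.
  exact: has_deriv_scale.
have GL : L b - L a = G by rewrite /L /G; ring.
have hr x : x \in `]a, b[ ->
    `|F' x| <= (lam * eps / Num.sqrt mu + mu^-1 * k x) * F x.
  move=> xab; rewrite [mu^-1 * _]mulrC; apply: energy_rate => //.
  - by rewrite sqrtr_gt0.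
  - by rewrite sqr_sqrtr// ltW.
  - exact: mud.
  - exact: dc.
  - exact: d'k.
rewrite -GL; split.
  by apply: (gronwall ab hF cF hL) => x /hr; rewrite ler_norml => /andP[].
by apply: (gronwall_rev ab hF cF hL) => x /hr; rewrite ler_norml => /andP[].
Qed.

(** * Spline test functions *)

Lemma deriv_le_diff (R : realType) (D D' L L' : R -> R) (a b : R) : a <= b ->
  (forall x, x \in `[a, b] -> has_deriv D x (D' x)) ->
  (forall x, x \in `[a, b] -> has_deriv L x (L' x)) ->
  (forall x, x \in `[a, b] -> `|D' x| <= L' x) -> `|D b - D a| <= L b - L a.
Proof.
move=> ab hD hL h.
have [|c cab] := @MVT_deriv _ (fun x => D x - L x) (fun x => D' x - L' x) a b ab.
  by move=> x xab; apply: has_derivB; [exact: hD|exact: hL].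
have [|c' c'ab] := @MVT_deriv _ (fun x => D x + L x) (fun x => D' x + L' x) a b ab.
  by move=> x xab; apply: has_derivD; [exact: hD|exact: hL].
have := h _ cab; have := h _ c'ab; rewrite !ler_norml => /andP[h1 h2] /andP[h3 h4].
move=> e1 e2; apply/andP; split; nra.
Qed.

Lemma integral_oo_antiderivative (R : realType) (f F : R -> R) (a b : R) : a < b ->
  continuous f -> (forall x, has_deriv F x (f x)) ->
  (\int[lebesgue_measure]_(x in `]a, b[) (f x)%:E = (F b - F a)%:E)%E.
Proof.
move=> ab cf hF; have cF := has_deriv_continuous hF.
have dF x : derivable F x 1 by case: (hF x).
rewrite -(@integral_itv_bndoo _ a b _ true false).
  rewrite (@continuous_FTC2 _ f F a b ab) ?EFinB//.
  - exact: continuous_subspaceT.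
  - split=> //; first exact: cvg_at_right_filter (cF a).
    exact: cvg_at_left_filter (cF b).
  - by move=> x _; rewrite derive1E; case: (hF x).
apply/measurable_EFinP; apply: (@measurable_funS _ _ _ _ setT) => //.
exact: continuous_measurable_fun.
Qed.

(** The difference quotient is within [|y - x|] of the limit, also across the kink at 0. *)
Lemma has_deriv_sqr_pos (R : realType) (x : R) :
  has_deriv (fun y : R => Num.max y 0 ^+ 2) x (2 * Num.max x 0).
Proof.
apply: has_deriv_eps => e e0; exists e => // y yx ye.
have yx0 : y - x != 0 by rewrite subr_eq0.
apply: le_trans (ltW ye).
rewrite -[X in _ - X](mulfK yx0) -mulrBl normrM normfV.
rewrite ler_pdivrMr ?normr_gt0// -normrM -expr2 (ger0_norm (sqr_ge0 _)).
rewrite ler_norml /Num.max; do !case: ifPn; rewrite -?leNgt => *; nra.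
Qed.

(* Quadratic B-spline primitive: a C^1 step from 0 to 1 on [0, 2], whose
   derivative is the hat function. *)
Definition step (R : realType) (x : R) : R :=
  (Num.max x 0 ^+ 2 - 2 * Num.max (x - 1) 0 ^+ 2 + Num.max (x - 2) 0 ^+ 2) / 2.

Definition hat (R : realType) (x : R) : R :=
  Num.max x 0 - 2 * Num.max (x - 1) 0 + Num.max (x - 2) 0.

Lemma has_deriv_step (R : realType) (x : R) : has_deriv (@step R) x (hat x).
Proof.
have h (r : R) : has_deriv (fun y => Num.max (y - r) 0 ^+ 2) x (2 * Num.max (x - r) 0).
  rewrite -[X in has_deriv _ _ X]mulr1.
  apply: (@has_deriv_comp _ (fun y => Num.max y 0 ^+ 2) (fun y => y - r)).
    exact: has_deriv_sqr_pos.
  rewrite -[X in has_deriv _ _ X]subr0.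
  by apply: has_derivB; [exact: is_derive_id|exact: is_derive_cst].
have -> : hat x = 2^-1 * (2 * Num.max x 0 - 2 * (2 * Num.max (x - 1) 0) + 2 * Num.max (x - 2) 0).
  by rewrite /hat; field.
rewrite /step; under [X in has_deriv X]eq_fun do rewrite mulrC.
apply: has_derivZ; apply: has_derivD => //; apply: has_derivB; first exact: has_deriv_sqr_pos.
exact: has_derivZ.
Qed.

Lemma step_bound (R : realType) (x : R) : 0 <= step x <= 1.
Proof.
rewrite /step /Num.max; apply/andP; split; do !case: ifPn; rewrite -?leNgt => *; nra.
Qed.

Lemma step0 (R : realType) (x : R) : x <= 0 -> step x = 0.
Proof.
by move=> x0; rewrite /step !max_r; [ring|lra..].
Qed.

Lemma step1 (R : realType) (x : R) : 2 <= x -> step x = 1.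
Proof.
by move=> x0; rewrite /step !max_l; [field|lra..].
Qed.

Lemma hat_ge0 (R : realType) (x : R) : 0 <= hat x.
Proof.
by rewrite /hat /Num.max; do !case: ifPn; rewrite -?leNgt => *; lra.
Qed.

Lemma hat0 (R : realType) (x : R) : (x <= 0) || (2 <= x) -> hat x = 0.
Proof.
by rewrite /hat /Num.max; do !case: ifPn; rewrite -?leNgt => *; lra.
Qed.

Lemma hat_continuous (R : realType) : continuous (@hat R).
Proof.
have h (r : R) : continuous (fun x => Num.max (x - r) 0).
  move=> x; apply/cvgrPdist_le => e e0; apply/nbhs_ballP; exists e => // y.
  rewrite /ball/= => /ltW yx; apply: le_trans yx.
  have := ler_norm (x - y); have := ler_norm (- (x - y)); rewrite normrN.
  by rewrite ler_norml /Num.max; do !case: ifPn; rewrite -?leNgt => *; lra.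
have -> : @hat R = fun x => Num.max (x - 0) 0 - 2 * Num.max (x - 1) 0 + Num.max (x - 2) 0.
  by apply/funext => x; rewrite subr0.
move=> x; apply: cvgD; last exact: h.
by apply: cvgB; [exact: h|apply: cvgM; [exact: cvg_cst|exact: h]].
Qed.

(** A C^1 approximation of the indicator of [[s, t]]: its derivative is a hat of mass 1 just after
    [s] minus one just after [t]. *)
Definition plateau (R : realType) (s t e x : R) : R :=
  step ((x - s) / e) - step ((x - t) / e).

Lemma has_deriv_step_affine (R : realType) (s e x : R) :
  has_deriv (fun x => step ((x - s) / e)) x (hat ((x - s) / e) / e).
Proof.
apply: (@has_deriv_comp _ (@step R) (fun x => (x - s) / e)); first exact: has_deriv_step.
under [X in has_deriv X]eq_fun do rewrite mulrC mulrBr.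
rewrite -[X in has_deriv _ _ X]subr0.
apply: has_derivB; last exact: is_derive_cst.
exact: has_deriv_scale.
Qed.

Lemma continuous_hat_affine (R : realType) (s e : R) :
  continuous (fun x => hat ((x - s) / e) / e).
Proof.
move=> x; apply: cvgM; last exact: cvg_cst.
apply: (@continuous_comp _ _ _ (fun x : R => (x - s) / e) (@hat R)).
  apply: cvgM; last exact: cvg_cst.
  by apply: cvgB; [exact: cvg_id|exact: cvg_cst].
exact: hat_continuous.
Qed.

Lemma has_deriv_plateau (R : realType) (s t e x : R) :
  has_deriv (plateau s t e) x (hat ((x - s) / e) / e - hat ((x - t) / e) / e).
Proof. by apply: has_derivB; exact: has_deriv_step_affine. Qed.

Lemma derive1_plateau (R : realType) (s t e : R) :
  derive1 (plateau s t e) = fun x => hat ((x - s) / e) / e - hat ((x - t) / e) / e.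
Proof.
by apply/funext => x; rewrite derive1E; case: (has_deriv_plateau s t e x).
Qed.

Lemma continuous_derive1_plateau (R : realType) (s t e : R) :
  continuous (derive1 (plateau s t e)).
Proof.
by rewrite derive1_plateau => x; apply: cvgB; exact: continuous_hat_affine.
Qed.

Lemma plateau0 (R : realType) (s t e x : R) : 0 < e -> s <= t ->
  (x < s) || (t + 2 * e < x) -> plateau s t e x = 0.
Proof.
move=> e0 st /orP[xs|xt].
  by rewrite /plateau !step0 ?subrr// ler_pdivrMr// mul0r; lra.
by rewrite /plateau !step1 ?subrr// ler_pdivlMr//; lra.
Qed.

Lemma plateau_test (R : realType) (T0 s t e : R) :
  0 < s -> s < t -> 0 < e -> t + 2 * e < T0 ->
  test_function 0 T0 (plateau s t e).
Proof.
move=> s0 st e0 tT; split.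
- by move=> x; case: (has_deriv_plateau s t e x).
- exact: continuous_derive1_plateau.
- exists `[s, t + 2 * e]%classic; split; first exact: segment_compact.
    by move=> x /=; rewrite !in_itv/= => /andP[? ?]; apply/andP; split; lra.
  move=> x /=; rewrite in_itv/= => /negP; rewrite negb_and -!ltNge.
  by move=> h; apply: plateau0 => //; exact: ltW.
Qed.

Lemma omega_small (R : realType) (omega : R -> R) (e : R) :
  modulus_of_continuity omega -> 0 < e ->
  exists2 d : R, 0 < d & forall x, 0 < x -> x <= d -> omega x <= e.
Proof.
move=> om e0; have := modulus_cvg0 om => /cvgrPdist_le/(_ e e0).
rewrite near_withinE => /nbhs_ballP[d /= d0 h].
exists (d / 2); first exact: divr_gt0.
move=> x x0 xd; have := h x; rewrite /ball/= !sub0r !normrN => h'.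
apply: le_trans (ler_norm _) (h' _ x0).
by rewrite gtr0_norm//; lra.
Qed.

(** * Lipschitz bounds from the weak derivative *)

Lemma ae_lebesgue_filterS (R : realType) (P Q : R -> Prop) : (forall x, P x -> Q x) ->
  {ae (@lebesgue_measure R), forall x, P x} ->
  {ae (@lebesgue_measure R), forall x, Q x}.
Proof.
by move=> PQ; apply: (@filterS _ _ (@ae_filter_ringOfSetsType _ _ _ (@lebesgue_measure R))).
Qed.

(** The plateau is at most 1 in absolute value and lives on [[s, t + 2 * e]], to the right of [s],
    where monotonicity bounds [|c'|] by [theta s]. *)
Lemma integral_plateau_le (R : realType) (T0 s t e : R) (theta c' : R -> R) :
  0 < s -> s < t -> 0 < e -> t + 2 * e < T0 ->
  {in `]0, T0[, forall t, 0 < theta t} ->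
  {in `]0, T0[ &, {homo theta : x y /~ x <= y}} ->
  measurable_fun `]0, T0[ c' ->
  {ae (@lebesgue_measure R), forall t, t \in `]0, T0[ -> `|c' t| <= theta t} ->
  `|\int[lebesgue_measure]_(x in `]0, T0[) (c' x * plateau s t e x)| <=
  theta s * (t - s + 2 * e).
Proof.
move=> s0 st e0 tT th0 thn mc' aeth.
have sI : s \in `]0, T0[ by rewrite in_itv/= s0/=; lra.
have ths := th0 _ sI.
have mI : measurable (`]0, T0[%classic : set R) by exact: measurable_itv.
have mf : measurable_fun `]0, T0[ (fun x => (c' x * plateau s t e x)%:E).
  apply/measurable_EFinP; apply: measurable_funM => //.
  apply: (@measurable_funS _ _ _ _ setT) => //.
  apply: continuous_measurable_fun; apply: has_deriv_continuous.
  exact: has_deriv_plateau.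
pose A : set R := `[s, t + 2 * e]%classic.
pose I : set R := `]0, T0[%classic.
have le1 : (`|\int[lebesgue_measure]_(x in I) (c' x * plateau s t e x)%:E|
    <= (theta s * (t - s + 2 * e))%:E)%E.
  have hle := le_abse_integral (@lebesgue_measure R) mI mf.
  apply: (le_trans hle) => {hle}.
  apply: (@le_trans _ _ (\int[@lebesgue_measure R]_(x in I)
      ((cst (theta s)%:E) \_ A) x)%E).
    apply: ae_ge0_le_integral => //.
    - exact: measurableT_comp.
    - by move=> x _; rewrite patchE; case: ifP => // _; rewrite lee_fin ltW.
    - have mA : measurable A by exact: measurable_itv.
      apply: (iffLR (@measurable_restrict _ _ _ _ A I (cst (theta s)%:E) mA mI)).
      exact: measurable_cst.
    - move: aeth; apply: ae_lebesgue_filterS => x hx xI; rewrite abse_EFin patchE.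
      case: ifPn => [/set_mem|].
        rewrite /A/= in_itv/= => /andP[sx _]; rewrite lee_fin normrM.
        rewrite -[theta s]mulr1; apply: ler_pM => //.
          by apply: (le_trans (hx xI)); apply: thn.
        have := step_bound ((x - s) / e); have := step_bound ((x - t) / e).
        by rewrite ler_norml /plateau; lra.
      move=> xA; rewrite plateau0 ?mulr0 ?normr0//; first exact: ltW.
      by move: xA; rewrite notin_setE /A/= in_itv/= => /negP; rewrite negb_and -!ltNge.
  have mIA : measurable (I `&` A) by apply: measurableI; exact: measurable_itv.
  rewrite -integral_mkcondr integral_cst//.
  rewrite EFinM; apply: lee_wpmul2l; first by rewrite lee_fin ltW.
  apply: (@le_trans _ _ (@lebesgue_measure R A)).
    by apply: le_measure; rewrite ?inE//; exact: measurable_itv.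
  rewrite /A lebesgue_measure_itv/= lte_fin; case: ifP => _; last by rewrite lee_fin; lra.
  by rewrite -EFinB lee_fin; lra.
rewrite /Rintegral -lee_fin.
have fn : (\int[lebesgue_measure]_(x in I) (c' x * plateau s t e x)%:E)%E \is a fin_num.
  by rewrite -abse_fin_num ge0_fin_numE//; apply: (le_lt_trans le1); rewrite ltry.
by rewrite -abse_EFin fineK.
Qed.

(** Testing the weak derivative with a plateau produces [c s - c t] up to the variation of [c] over
    windows of length [2 * e], which [omega] controls; then [e] tends to 0. *)
Lemma PS_lipschitz_interior (R : realType) (T0 mu1 mu2 : R) (omega theta c : R -> R) (s t : R) :
  0 < T0 -> modulus_of_continuity omega ->
  {in `]0, T0[, forall t, 0 < theta t} ->
  {in `]0, T0[ &, {homo theta : x y /~ x <= y}} ->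
  in_PS T0 mu1 mu2 omega theta c -> 0 < s -> s < t -> t < T0 ->
  `|c t - c s| <= theta s * (t - s).
Proof.
move=> T00 om th0 thn [cc _ cmod [c' [_ [mc' _] wk] aeth]] s0 st tT.
have sI : s \in `]0, T0[ by rewrite in_itv/= s0/=; lra.
have ths := th0 _ sI.
pose cb x := c (clamp 0 T0 x).
have ccb : continuous cb by apply: continuous_clamp => //; exact: ltW.
have key e W : 0 < e -> t + 2 * e < T0 -> 0 <= W ->
    (forall x, 0 < x -> x <= 2 * e -> omega x <= W) ->
    `|c t - c s| <= theta s * (t - s + 2 * e) + 2 * W.
  move=> e0 tT0 W0 hW.
  have hphi := wk _ (plateau_test s0 st e0 tT0).
  have [P hP] : exists P : R -> R, forall x,
      has_deriv P x (cb x * derive1 (plateau s t e) x).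
    apply: antiderivative => x; apply: cvgM; first exact: ccb.
    exact: continuous_derive1_plateau.
  have EP : \int[lebesgue_measure]_(x in `]0, T0[) (c x * derive1 (plateau s t e) x) = P T0 - P 0.
    have := @integral_oo_antiderivative _ (fun x => cb x * derive1 (plateau s t e) x) P 0 T0 T00.
    move=> /(_ _ hP) H.
    rewrite -[RHS]/(fine (P T0 - P 0)%:E) -H; last first.
      by move=> x; apply: cvgM; [exact: ccb|exact: continuous_derive1_plateau].
    apply: eq_Rintegral => x; rewrite inE/= in_itv/= => /andP[? ?].
    by rewrite /cb clamp_id//; apply/andP; split; exact: ltW.
  have := integral_plateau_le s0 st e0 tT0 th0 thn mc' aeth.
  rewrite -normrN -hphi EP => hr.
  (* Over [[0, T0]], [D] changes by the tested integral plus [c t - c s]. Its derivative contains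
     [c - c s] and [c - c t] only where the respective hat is nonzero, so it is dominated by that of
     [L], whose total increase is [2 * W]. *)
  pose D x := P x - c s * step ((x - s) / e) + c t * step ((x - t) / e).
  pose L x := W * (step ((x - s) / e) + step ((x - t) / e)).
  have : `|D T0 - D 0| <= L T0 - L 0.
    apply: (@deriv_le_diff _ D (fun x => cb x * (hat ((x - s) / e) / e - hat ((x - t) / e) / e)
        - c s * (hat ((x - s) / e) / e) + c t * (hat ((x - t) / e) / e))
      L (fun x => W * (hat ((x - s) / e) / e + hat ((x - t) / e) / e))).
    - exact: ltW.
    - move=> x _; apply: has_derivD; last by apply: has_derivZ; exact: has_deriv_step_affine.
      apply: has_derivB; last by apply: has_derivZ; exact: has_deriv_step_affine.
      by have := hP x; rewrite derive1_plateau.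
    - by move=> x _; apply: has_derivZ; apply: has_derivD; exact: has_deriv_step_affine.
    move=> x xI.
    have hh r : r \in `[0, T0] -> `|(cb x - c r) * (hat ((x - r) / e) / e)| <= W * (hat ((x - r) / e) / e).
      move=> rI.
      have hr0 : 0 <= hat ((x - r) / e) / e by rewrite divr_ge0 ?hat_ge0 ?ltW.
      have [h0|h0] := boolP (((x - r) / e <= 0) || (2 <= (x - r) / e)).
        by rewrite hat0// mul0r !mulr0 normr0.
      move: h0; rewrite negb_or -!ltNge ltr_pdivlMr// ltr_pdivrMr// mul0r => /andP[xr xr2].
      rewrite normrM (ger0_norm hr0); apply: ler_wpM2r => //.
      rewrite /cb clamp_id; last by move: xI; rewrite in_itv.
      apply: (le_trans (cmod _ _ xI rI)).
      by rewrite gtr0_norm//; apply: hW => //; lra.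
    have hs : s \in `[0, T0] by rewrite in_itv/=; lra.
    have ht : t \in `[0, T0] by rewrite in_itv/=; lra.
    have := lerD (hh _ hs) (hh _ ht); rewrite -mulrDr; apply: le_trans.
    apply: le_trans (ler_normB _ _).
    by rewrite le_eqVlt; apply/orP; left; apply/eqP; congr `|_|; ring.
  rewrite /D /L (@step1 _ ((T0 - s) / e)) ?ler_pdivlMr//; last by lra.
  rewrite (@step1 _ ((T0 - t) / e)) ?ler_pdivlMr//; last by lra.
  rewrite (@step0 _ ((0 - s) / e)) ?ler_pdivrMr ?mul0r//; last by lra.
  rewrite (@step0 _ ((0 - t) / e)) ?ler_pdivrMr ?mul0r//; last by lra.
  move: hr; rewrite !ler_norml !mulr1 !mulr0; lra.
apply/ler_addgt0Pr => r r0.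
have [d d0 hd] := omega_small om (divr_gt0 r0 (ltr0n R 4)).
(* In this order: [omega] is at most [r / 4] up to [2 * e], the support stays below [T0], and the
   excess length costs at most [r / 2]. *)
pose e := Num.min (Num.min (d / 2) ((T0 - t) / 3)) (r / (4 * theta s)).
have e0 : 0 < e.
  have h1 : 0 < d / 2 by rewrite divr_gt0.
  have h2 : 0 < (T0 - t) / 3 by rewrite divr_gt0// subr_gt0.
  have h3 : 0 < r / (4 * theta s) by rewrite divr_gt0// mulr_gt0.
  by rewrite !lt_min h1 h2.
have : e <= Num.min (Num.min (d / 2) ((T0 - t) / 3)) (r / (4 * theta s)) by [].
rewrite !le_min => /andP[/andP[ed eT] er].
have {}er : theta s * e <= r / 4.
  by move: er; rewrite ler_pdivlMr ?mulr_gt0//; lra.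
have := key e (r / 4) e0 ltac:(lra) ltac:(lra) => h.
have := h (fun x x0 xe => hd x x0 ltac:(lra)); lra.
Qed.

(** Continuity of [c] adds the endpoint [T0], which averaging windows do reach. *)
Lemma PS_lipschitz (R : realType) (T0 mu1 mu2 : R) (omega theta c : R -> R) (s t : R) :
  0 < T0 -> modulus_of_continuity omega ->
  {in `]0, T0[, forall t, 0 < theta t} ->
  {in `]0, T0[ &, {homo theta : x y /~ x <= y}} ->
  in_PS T0 mu1 mu2 omega theta c -> 0 < s -> s < t -> t <= T0 ->
  `|c t - c s| <= theta s * (t - s).
Proof.
move=> T00 om th0 thn hc s0 st tT; apply/ler_addgt0Pr => r r0.
have [cc _ _ _] := hc.
have tI : `[0, T0]%classic t by rewrite /= in_itv/= tT andbT ltW// (lt_trans s0).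
have [d d0 hd] := within_continuous_eps cc tI r0.
pose e := Num.min d (t - s) / 2.
have e0 : 0 < e by rewrite divr_gt0// lt_min d0 subr_gt0.
have : e * 2 <= Num.min d (t - s) by rewrite divfK.
rewrite le_min => /andP[ed et].
have h1 := @PS_lipschitz_interior _ _ _ _ _ _ _ s (t - e) T00 om th0 thn hc s0 ltac:(lra) ltac:(lra).
have h2 := hd (t - e).
have {}h2 : `|c (t - e) - c t| <= r.
  apply: h2; first by rewrite /= in_itv/=; lra.
  by rewrite (_ : t - e - t = - e) ?normrN ?gtr0_norm//; [lra|ring].
have ths : 0 < theta s by apply: th0; rewrite in_itv/=; lra.
have : theta s * (t - e - s) <= theta s * (t - s) by rewrite ler_pM2l//; lra.
by move: h1 h2; rewrite !ler_norml; lra.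
Qed.

(** * Smooth coefficients and the L^oo distance *)

Lemma continuous_Linfty_loc (R : realType) (a b : R) (f : R -> R) :
  a <= b -> continuous f -> Linfty_loc a b f.
Proof.
move=> ab cf; split.
  apply: (@measurable_funS _ _ _ _ setT) => //.
  exact: continuous_measurable_fun.
move=> K _ Kab.
have cn : {within `[a, b], continuous (fun x => `|f x|)}.
  apply: continuous_subspaceT => x.
  by apply: (@continuous_comp _ _ _ f Num.norm); [exact: cf|exact: norm_continuous].
have [m _ hm] := EVT_max ab cn.
exists `|f m|; apply: nearW => t /Kab tab; apply: hm.
exact: subset_itv_oo_cc.
Qed.

Lemma C1_weak_derivative (R : realType) (a b : R) (f f' : R -> R) : a < b ->
  (forall x, has_deriv f x (f' x)) -> continuous f' -> weak_derivative a b f f'.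
Proof.
move=> ab hf cf' phi [dphi cdphi [K [_ Kab phi0]]].
have cf := has_deriv_continuous hf.
have hphi x : has_deriv phi x (derive1 phi x).
  by split; [exact: dphi|rewrite derive1E].
have cphi := has_deriv_continuous hphi.
have z x : x = a \/ x = b -> phi x = 0.
  by move=> xE; apply: phi0 => /Kab; rewrite /= in_itv/=; case: xE => ->; rewrite ltxx ?andbF.
have c1 : continuous (fun x => f x * derive1 phi x).
  by move=> x; apply: cvgM; [exact: cf|exact: cdphi].
have c2 : continuous (fun x => f' x * phi x).
  by move=> x; apply: cvgM; [exact: cf'|exact: cphi].
have i (g : R -> R) : continuous g ->
    (@lebesgue_measure R).-integrable (`]a, b[%classic : set R) (EFin \o g).
  move=> cg; have h : (@lebesgue_measure R).-integrable (`[a, b]%classic : set R) (EFin \o g).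
    apply: continuous_compact_integrable; first exact: segment_compact.
    exact: continuous_subspaceT.
  apply: (integrableS _ _ _ h); [exact: measurable_itv|exact: measurable_itv|].
  by move=> x; exact: subset_itv_oo_cc.
apply/eqP; rewrite -addr_eq0 addrC -RintegralD//; [|exact: i..].
have := @integral_oo_antiderivative _ (fun x => f' x * phi x + f x * derive1 phi x)
  (fun x => f x * phi x) a b ab.
move=> H; rewrite /Rintegral H.
- by rewrite /= !z ?mulr0 ?subrr//; [left|right].
- by move=> x; apply: cvgD; [exact: c2|exact: c1].
- by move=> x; exact: has_derivM.
Qed.

Lemma C1_in_PS (R : realType) (T0 mu1 mu2 : R) (omega theta c c' : R -> R) :
  0 < T0 -> (forall x, has_deriv c x (c' x)) -> continuous c' ->
  (forall x, x \in `[0, T0] -> mu1 <= c x <= mu2) ->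
  (forall x y, x \in `[0, T0] -> y \in `[0, T0] -> `|c x - c y| <= omega `|x - y|) ->
  (forall x, x \in `]0, T0[ -> `|c' x| <= theta x) ->
  in_PS T0 mu1 mu2 omega theta c.
Proof.
move=> T00 hc cc' cmu com cth; have cc := has_deriv_continuous hc; split.
- exact: continuous_subspaceT.
- by move=> t; exact: cmu.
- by move=> t s tI sI; exact: com.
exists c'; last by apply: nearW => t; exact: cth.
split; [exact: continuous_Linfty_loc (ltW T00) cc|exact: continuous_Linfty_loc (ltW T00) cc'|].
exact: C1_weak_derivative.
Qed.

(** Near each point of [[a, b]], endpoints included, the open interval contains an interval of
    positive length, which no null set can cover. *)
Lemma ae_open_le (R : realType) (a b M : R) (f : R -> R) : a < b ->
  {within `[a, b], continuous f} ->
  {ae (@lebesgue_measure R), forall x, x \in `]a, b[ -> f x <= M} ->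
  forall x, x \in `[a, b] -> f x <= M.
Proof.
move=> ab cf [N [mN N0 hN]] x xI; apply/ler_addgt0Pr => e e0.
have [d d0 hd] := within_continuous_eps cf xI e0.
pose l := Num.max a (x - d); pose r := Num.min b (x + d).
have lr : l < r.
  move: xI; rewrite in_itv/= => /andP[ax xb].
  by rewrite /l /r /Num.max /Num.min; do !case: ifPn; rewrite -?leNgt => *; lra.
have [y /= ylr yN] : exists2 y, (y \in `]l, r[) & (~ N y).
  apply: contrapT => H.
  have sN : `]l, r[%classic `<=` N.
    by move=> y ylr; apply: contrapT => yN; apply: H; exists y.
  have : (@lebesgue_measure R `]l, r[ <= lebesgue_measure N)%E.
    by apply: le_measure; rewrite ?inE.
  by rewrite N0 lebesgue_measure_itv/= lte_fin lr -EFinB lee_fin leNgt subr_gt0 lr.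
have [yab yx] : (y \in `]a, b[) /\ `|y - x| < d.
  move: ylr; rewrite !in_itv/= /l /r gt_max lt_min => /andP[/andP[? ?] /andP[? ?]].
  by split; [lra|rewrite ltr_norml; lra].
have := hd y (subset_itv_oo_cc yab) yx.
have : f y <= M by apply: contrapT => h; apply: yN; apply: hN => /= /(_ yab).
by rewrite ler_norml; lra.
Qed.

Lemma Linfty_dist_pointwise (R : realType) (T0 r : R) (f g : R -> R) : 0 < T0 ->
  {within `[0, T0], continuous f} -> {within `[0, T0], continuous g} ->
  (Linfty_dist T0 f g < r%:E)%E ->
  forall x, x \in `[0, T0] -> `|f x - g x| <= r.
Proof.
move=> T00 cf cg; rewrite Linfty_distE => /ltW /ess_supP h.
have cfg : {within `[0, T0], continuous (fun x => `|f x - g x|)}.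
  move: cf cg => /subspace_continuousP cf /subspace_continuousP cg.
  apply/subspace_continuousP => x xI; apply: cvg_norm.
  by apply: cvgB; [exact: cf|exact: cg].
apply: (ae_open_le T00 cfg).
move: h; apply: ae_lebesgue_filterS => x /= + xI.
by rewrite patchE mem_set//= lee_fin.
Qed.

Lemma Linfty_dist_le (R : realType) (T0 r : R) (f g : R -> R) : 0 <= r ->
  (forall x, x \in `]0, T0[ -> `|f x - g x| <= r) ->
  (Linfty_dist T0 f g <= r%:E)%E.
Proof.
move=> r0 h; rewrite Linfty_distE; apply/ess_supP; apply: nearW => x /=.
rewrite patchE; case: ifPn => [/set_mem/h|_]; first by rewrite lee_fin.
by rewrite normr0 lee_fin.
Qed.

(** * The upper bound *)

Lemma energy_equiv (R : realType) (mu1 mu2 lam d u v : R) :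
  mu1 <= d <= mu2 ->
  v ^+ 2 + lam ^+ 2 * d * u ^+ 2 <= Num.max 1 mu2 * (v ^+ 2 + lam ^+ 2 * u ^+ 2) /\
  Num.min 1 mu1 * (v ^+ 2 + lam ^+ 2 * u ^+ 2) <= v ^+ 2 + lam ^+ 2 * d * u ^+ 2.
Proof.
move=> /andP[d1 d2].
have v0 := sqr_ge0 v; have := sqr_ge0 (lam * u); rewrite exprMn => u0.
have [m1 m2] : 1 <= Num.max 1 mu2 /\ mu2 <= Num.max 1 mu2.
  by rewrite !le_max !lexx orbT.
have [m3 m4] : Num.min 1 mu1 <= 1 /\ Num.min 1 mu1 <= mu1.
  by rewrite !ge_min !lexx orbT.
have e1 : lam ^+ 2 * d * u ^+ 2 = d * (lam ^+ 2 * u ^+ 2) by ring.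
rewrite e1; split; rewrite mulrDr lerD//.
- by rewrite ler_peMl.
- by apply: ler_wpM2r => //; exact: le_trans m2.
- by rewrite ler_piMl.
- by apply: ler_wpM2r => //; exact: le_trans d1.
Qed.

Lemma le_expR_lim (R : realType) (A B J : R) :
  (forall r, 0 < r -> A <= B * expR (r + J)) -> A <= B * expR J.
Proof.
move=> h; have := @within_le R (cst A) (fun r => B * expR (r + J)) 0 1 ltr01.
rewrite /cst add0r; apply.
- by apply: continuous_subspaceT => x; exact: cst_continuous.
- apply: continuous_subspaceT => x; apply: cvgM; first exact: cvg_cst.
  apply: (@continuous_comp _ _ _ (fun r => r + J) expR).
    by apply: cvgD; [exact: cvg_id|exact: cvg_cst].
  exact: continuous_expR.
- by move=> x y x0 _ _; exact: h.
Qed.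

Lemma mollify_modulus (R : realType) (omega f : R -> R) (mu1 mu2 e : R) : 0 < e ->
  modulus_of_continuity omega -> continuous f ->
  (forall x, mu1 <= f x <= mu2) -> (forall x y, `|f x - f y| <= omega `|x - y|) ->
  exists g : R -> R, [/\ forall x, has_deriv g x ((f (x + e) - f x) / e),
    forall x, mu1 <= g x <= mu2, forall x, `|g x - f x| <= omega e &
    forall x y, exists r, g x - g y = f (x + r) - f (y + r)].
Proof.
move=> e0 om cf fmu fom; have [g [dg vg gg]] := mollify e0 cf.
exists g; split=> // x; have [y + ->] := vg x; first by move=> _; exact: fmu.
rewrite in_itv/= => /andP[xy yx]; apply: (le_trans (fom _ _)).
apply: (modulus_nondecreasing om); rewrite ?in_itv/= ?andbT ?(ltW e0)//.
by rewrite ger0_norm ?subr_ge0// lerBlDl.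
Qed.

Section PS_facts.
Variables (R : realType) (T0 mu1 mu2 : R) (omega theta c : R -> R).
Hypotheses (T00 : 0 < T0) (mu10 : 0 < mu1) (om : modulus_of_continuity omega)
  (th0 : {in `]0, T0[, forall t, 0 < theta t})
  (thc : {in `]0, T0[, continuous theta})
  (thn : {in `]0, T0[ &, {homo theta : x y /~ x <= y}})
  (hc : in_PS T0 mu1 mu2 omega theta c).

(** The projection is 1-Lipschitz, so the modulus survives. The case [a = 0] extends the
    coefficient; a positive [a] also makes it constant to the left of [a]. *)
Lemma PS_clamp (a : R) : 0 <= a <= T0 -> let f x := c (clamp a T0 x) in
  [/\ continuous f, forall x, mu1 <= f x <= mu2 &
      forall x y, `|f x - f y| <= omega `|x - y|].
Proof.
move=> /andP[a0 aT] f; have [cc cmu com _] := hc.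
have cI x : clamp a T0 x \in `[0, T0].
  have /andP[h1 h2] := clamp_itv x aT.
  by rewrite in_itv/= h2 andbT; exact: le_trans h1.
split=> [|x|x y].
- apply: continuous_clamp => //; apply: continuous_subspaceW cc => x /=.
  by rewrite !in_itv/= => /andP[h ->]; rewrite andbT (le_trans a0).
- exact: cmu.
- apply: (le_trans (com _ _ (cI x) (cI y))).
  by apply: (modulus_nondecreasing om); rewrite ?in_itv/= ?andbT// clamp_lip.
Qed.

Lemma energy_modulus_bound (lam : R) (u u' : R -> R) (t : R) :
  0 < lam -> solves T0 lam c u u' -> t \in `[0, T0] ->
  Num.min 1 mu1 * (u' t ^+ 2 + lam ^+ 2 * u t ^+ 2) <=
  Num.max 1 mu2 * (u' 0 ^+ 2 + lam ^+ 2 * u 0 ^+ 2) *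
    expR ((1 / mu1 + 1 / Num.sqrt mu1) * (lam * omega (1 / lam) * t)).
Proof.
move=> lam0 hu; rewrite in_itv/= => /andP[t0 tT].
have [|cf fmu fom] := @PS_clamp 0; first by rewrite lexx ltW.
have il : 0 < 1 / lam by rewrite divr_gt0.
have [g [dg gmu gf _]] := mollify_modulus il om cf fmu fom.
pose L := lam * omega (1 / lam).
have hK (x : R) : has_deriv (fun x => L * x) x L.
  exact: has_deriv_scale.
have [|||h _] := energy_gronwall lam0 mu10 (lexx 0) t0 tT hu dg hK (eps := omega (1 / lam)).
- by move=> x _; have /andP[] := gmu x.
- move=> x; rewrite in_itv/= => /andP[x0 xt].
  have := gf x; rewrite clamp_id//; apply/andP; split; lra.
- move=> x _; rewrite normrM (ger0_norm (_ : 0 <= (1 / lam)^-1)); last first.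
    by rewrite invr_ge0 ltW.
  rewrite div1r invrK /L mulrC; apply: ler_wpM2l; first exact: ltW.
  apply: (le_trans (fom _ _)).
  by rewrite addrAC subrr add0r gtr0_norm ?invr_gt0// div1r.
have [h1 _] := energy_equiv lam (u 0) (u' 0) (gmu 0).
have [_ h2] := energy_equiv lam (u t) (u' t) (gmu t).
apply: (le_trans h2); apply: (le_trans h).
(* Origin of M2: the error of averaging enters with [1 / sqrt mu1], the slope of the average with
   [1 / mu1]. *)
have -> : lam * omega (1 / lam) / Num.sqrt mu1 * (t - 0) + (L * t - L * 0) / mu1
   = (1 / mu1 + 1 / Num.sqrt mu1) * (L * t).
  by rewrite /L !div1r; ring.
by apply: ler_wpM2r; [exact: expR_ge0|exact: h1].
Qed.

(** Staying inside [(0, T0)] keeps [theta] continuous on [[s, t]] and leaves room for a window to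
    the right of [t]. *)
Lemma energy_theta_bound_oo (lam s t I : R) (u u' : R -> R) :
  0 < lam -> solves T0 lam c u u' -> 0 < s -> s < t -> t < T0 ->
  (\int[@lebesgue_measure R]_(x in (`]s, T0[%classic : set R)) (theta x)%:E <= I%:E)%E ->
  Num.min 1 mu1 * (u' t ^+ 2 + lam ^+ 2 * u t ^+ 2) <=
  Num.max 1 mu2 * (u' s ^+ 2 + lam ^+ 2 * u s ^+ 2) * expR (I / mu1).
Proof.
move=> lam0 hu s0 st tT hI.
have [|cf fmu fom] := @PS_clamp 0; first by rewrite lexx ltW.
have thcl : continuous (fun x => theta (clamp s t x)).
  apply: continuous_clamp; first exact: ltW.
  apply: continuous_in_subspaceT => x; rewrite inE/= in_itv/= => /andP[sx xt].
  by apply: thc; rewrite in_itv/=; apply/andP; split; lra.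
have [K hK] := antiderivative thcl.
have KI : K t - K s <= I.
  rewrite -lee_fin -(integral_oo_antiderivative st thcl hK); apply: le_trans hI.
  apply: (@le_trans _ _ (\int[@lebesgue_measure R]_(x in (`]s, t[%classic : set R)) (theta x)%:E)%E).
    rewrite le_eqVlt; apply/orP; left; apply/eqP; apply: eq_integral => x.
    rewrite inE/= in_itv/= => /andP[? ?]; rewrite clamp_id//.
    by apply/andP; split; exact: ltW.
  have sub : (`]s, T0[%classic : set R) `<=` `]0, T0[%classic.
    by move=> x /=; rewrite !in_itv/= => /andP[? ->]; rewrite andbT; lra.
  apply: ge0_subset_integral => //.
  - apply/measurable_EFinP; apply: (measurable_funS _ sub) => //.
    apply: open_continuous_measurable_fun; first exact: interval_open.
    by move=> x; rewrite inE/= => /thc.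
  - by move=> x /sub /th0 /ltW; rewrite lee_fin.
  - by move=> x /=; rewrite !in_itv/= => /andP[-> ?]; lra.
have sm : 0 < Num.sqrt mu1 by rewrite sqrtr_gt0.
apply: le_expR_lim => r r0.
(* If [omega e <= q], the error of averaging adds at most [r] to the exponent. *)
pose q := r * Num.sqrt mu1 / (lam * (t - s)).
have q0 : 0 < q by rewrite divr_gt0 ?mulr_gt0// subr_gt0.
have [e0 e00 he0] := omega_small om q0.
pose e := Num.min e0 (T0 - t).
have epos : 0 < e by rewrite lt_min e00 subr_gt0.
have : e <= Num.min e0 (T0 - t) by [].
rewrite le_min => /andP[ee0 eT].
have [g [dg gmu gf _]] := mollify_modulus epos om cf fmu fom.
have [|||h _] := energy_gronwall lam0 mu10 (ltW s0) (ltW st) (ltW tT) hu dg hK (eps := omega e).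
- by move=> x _; have /andP[] := gmu x.
- move=> x; rewrite in_itv/= => /andP[sx xt].
  have := gf x; rewrite clamp_id//; apply/andP; split; lra.
- move=> x; rewrite in_itv/= => /andP[sx xt].
  rewrite !clamp_id; [|apply/andP; split; lra..].
  rewrite normrM (ger0_norm (_ : 0 <= e^-1)); last by rewrite invr_ge0 ltW.
  rewrite ler_pdivrMr//.
  (* The slope of the average at [x] is a difference quotient of [c] over [[x, x + e]], hence at
     most [theta x] for every window. *)
  have := @PS_lipschitz _ _ _ _ _ _ _ x (x + e) T00 om th0 thn hc.
  by rewrite addrAC subrr add0r; apply; lra.
have [h1 _] := energy_equiv lam (u s) (u' s) (gmu s).
have [_ h2] := energy_equiv lam (u t) (u' t) (gmu t).
apply: (le_trans h2); apply: (le_trans h).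
apply: ler_pM; [|exact: expR_ge0|exact: h1|].
  apply: addr_ge0; first exact: sqr_ge0.
  rewrite mulr_ge0 ?sqr_ge0// mulr_ge0 ?sqr_ge0//.
  by have /andP[+ _] := gmu s; apply: le_trans; exact: ltW.
rewrite ler_expR; apply: lerD; last by apply: ler_wpM2r => //; rewrite invr_ge0 ltW.
have := he0 e epos ee0; rewrite /q ler_pdivlMr ?mulr_gt0 ?subr_gt0// => h3.
rewrite mulrAC ler_pdivrMr//; apply: le_trans h3.
by rewrite le_eqVlt; apply/orP; left; apply/eqP; ring.
Qed.

(** The energy is continuous up to the endpoints, so the bound extends to [s = 0] and [t = T0], with
    [I] fixed as a bound for the largest tail. *)
Lemma energy_theta_bound (lam s t I : R) (u u' : R -> R) :
  0 < lam -> solves T0 lam c u u' -> 0 <= s -> s < t -> t <= T0 ->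
  (\int[@lebesgue_measure R]_(x in (`]s, T0[%classic : set R)) (theta x)%:E <= I%:E)%E ->
  Num.min 1 mu1 * (u' t ^+ 2 + lam ^+ 2 * u t ^+ 2) <=
  Num.max 1 mu2 * (u' s ^+ 2 + lam ^+ 2 * u s ^+ 2) * expR (I / mu1).
Proof.
move=> lam0 hu s0 st tT hI; have [hu1 [u'' hu2 _]] := hu.
have sub : (`[s, t]%classic : set R) `<=` `[0, T0]%classic.
  by move=> x /=; rewrite !in_itv/= => /andP[? ?]; apply/andP; split; lra.
have cu := continuous_subspaceW sub (derivative_on_continuous hu1).
have cu' := continuous_subspaceW sub (derivative_on_continuous hu2).
have cc (k : R) : {within `[s, t], continuous (fun=> k)}.
  by apply: continuous_subspaceT => x; exact: cst_continuous.
have cE : {within `[s, t], continuous (fun x => u' x ^+ 2 + lam ^+ 2 * u x ^+ 2)}.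
  apply: within_continuousD_fun; first exact: (within_continuousM_fun cu' cu').
  by apply: within_continuousM_fun; [exact: cc|exact: (within_continuousM_fun cu cu)].
apply: (@within_le R (fun x => Num.min 1 mu1 * (u' x ^+ 2 + lam ^+ 2 * u x ^+ 2))
  (fun x => Num.max 1 mu2 * (u' x ^+ 2 + lam ^+ 2 * u x ^+ 2) * expR (I / mu1)) s t st).
- by apply: within_continuousM_fun; [exact: cc|exact: cE].
- by apply: within_continuousM_fun; [apply: within_continuousM_fun; [exact: cc|exact: cE]|exact: cc].
move=> x y sx xy yt; apply: energy_theta_bound_oo => //; [lra|lra|].
apply: le_trans hI.
have subs : (`]s, T0[%classic : set R) `<=` `]0, T0[%classic.
  by move=> z /=; rewrite !in_itv/= => /andP[? ->]; rewrite andbT; lra.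
apply: ge0_subset_integral => //.
- apply/measurable_EFinP; apply: (measurable_funS _ subs) => //.
  apply: open_continuous_measurable_fun; first exact: interval_open.
  by move=> z; rewrite inE/= => /thc.
- by move=> z /subs /th0 /ltW; rewrite lee_fin.
- by move=> z /=; rewrite !in_itv/= => /andP[? ->]; rewrite andbT; lra.
Qed.

Lemma energy_upper_bound (lam t : R) (u u' : R -> R) :
  0 < lam -> mu1 < mu2 -> solves T0 lam c u u' -> t \in `[0, T0] ->
  u' t ^+ 2 + lam ^+ 2 * u t ^+ 2 <=
  (Num.max 1 mu2 / Num.min 1 mu1) ^+ 2 * (u' 0 ^+ 2 + lam ^+ 2 * u 0 ^+ 2) *
  expR ((1 / mu1 + 1 / Num.sqrt mu1) * m_lambda T0 omega theta lam).
Proof.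
move=> lam0 mu12 hu tI.
have [s sI [smin _]] := m_lambdaP T00 om th0 thc thn lam0.
set m := m_lambda T0 omega theta lam in smin *.
set M2 := 1 / mu1 + 1 / Num.sqrt mu1.
set mx := Num.max 1 mu2; set mn := Num.min 1 mu1.
pose E x := u' x ^+ 2 + lam ^+ 2 * u x ^+ 2.
have E0 x : 0 <= E x by rewrite addr_ge0 ?sqr_ge0// mulr_ge0 ?sqr_ge0.
have mx1 : 1 <= mx by rewrite le_max lexx.
have mn1 : mn <= 1 by rewrite ge_min lexx.
have mn0 : 0 < mn by rewrite lt_min ltr01.
have q1 : 1 <= mx / mn by rewrite ler_pdivlMr// mul1r (le_trans mn1).
have M20 : 0 <= M2 by rewrite addr_ge0// divr_ge0// ?sqrtr_ge0// ltW.
pose L := lam * omega (1 / lam).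
have L0 : 0 <= L by rewrite mulr_ge0 ?(ltW lam0)// (modulus_ge0 om)// divr_ge0 ?ltW.
move: (sI); rewrite in_itv/= => /andP[s0 sT].
pose J := (\int[@lebesgue_measure R]_(x in (`]s, T0[%classic : set R)) (theta x)%:E)%E.
have J0 : (0 <= J)%E.
  apply: integral_ge0 => x /=; rewrite in_itv/= => /andP[sx xT].
  by rewrite lee_fin ltW// th0// in_itv/= xT andbT (le_lt_trans s0).
(* The tail at the minimizer is finite because the minimum is a real number. *)
have [I JI] : exists I : R, J = I%:E.
  exists (fine J); rewrite fineK// ge0_fin_numE// ltey.
  by apply/eqP => Joo; move: smin; rewrite /m_cost -/L -/J Joo addey.
have I0 : 0 <= I by rewrite -lee_fin -JI.
have mE : m = L * s + I.
  by apply/eqP; rewrite -eqe -smin /m_cost -/L -/J JI.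
have hA x : x \in `[0, T0] -> E x <= mx / mn * E 0 * expR (M2 * (L * x)).
  move=> xI; rewrite (_ : _ * expR _ = mx * E 0 * expR (M2 * (L * x)) / mn); last by ring.
  by rewrite ler_pdivlMr// mulrC; exact: (energy_modulus_bound lam0 hu xI).
(* Up to [s] the first estimate suffices. Beyond [s] the two are chained, and each costs a factor
   [mx / mn]; this is why M1 is a square. *)
have [ts|st] := leP t s.
  apply: (le_trans (hA _ tI)).
  have t0 : 0 <= t by move: tI; rewrite in_itv/= => /andP[].
  have h1 : mx / mn * E 0 <= (mx / mn) ^+ 2 * E 0.
    apply: ler_wpM2r => //; rewrite expr2 ler_peMl//; lra.
  apply: ler_pM => //; first by rewrite mulr_ge0//; lra.
  by rewrite ler_expR; apply: ler_wpM2l => //; rewrite mE; nra.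
have tT : t <= T0 by move: tI; rewrite in_itv/= => /andP[].
have := energy_theta_bound (I := I) lam0 hu s0 st tT.
rewrite -/J JI lexx => /(_ isT); rewrite -/mx -/mn -/(E t) -/(E s) => hB.
have {}hB : E t <= mx / mn * E s * expR (I / mu1).
  rewrite (_ : _ * expR _ = mx * E s * expR (I / mu1) / mn); last by ring.
  by rewrite ler_pdivlMr// mulrC.
apply: (le_trans hB).
have h2 := hA _ sI.
have -> : (mx / mn) ^+ 2 * (u' 0 ^+ 2 + lam ^+ 2 * u 0 ^+ 2) * expR (M2 * m) =
  mx / mn * (mx / mn * E 0 * expR (M2 * (L * s))) * expR (M2 * I).
  by rewrite mE [M2 * (_ + _)]mulrDr expRD /E; ring.
apply: ler_pM; [by rewrite mulr_ge0//; lra|exact: expR_ge0| |].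
  by apply: ler_wpM2l => //; lra.
rewrite ler_expR mulrC; apply: ler_wpM2r => //.
by rewrite /M2 div1r lerDl divr_ge0// sqrtr_ge0.
Qed.

End PS_facts.

(** * Resonant oscillations *)

Section step_amplitude.
Variables (R : realType) (nu M : R) (a : nat -> R).
Hypotheses (nu0 : 0 < nu) (a0 : forall i, 0 <= a i) (aM : forall i, a i <= M).

Let h : R := pi / nu.

Let h0 : 0 < h. Proof. by rewrite divr_gt0// pi_gt0. Qed.

(** Equal to [a i] on the half period number [i] of [sin (nu t)], left end included. Truncation
    sends negative numbers to 0, so [a 0] also serves all [t < 0]. *)
Definition amplitude (t : R) : R := a (Num.truncn (t / h)).

Lemma sin_node (i : nat) : sin (nu * (i%:R * h)) = 0.
Proof.
have -> : nu * (i%:R * h) = i%:R * pi by rewrite /h mulrCA [nu * _]mulrC divfK ?gt_eqF.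
elim: i => [|i IH]; first by rewrite mul0r sin0.
by rewrite -natr1 mulrDl mul1r sinDpi IH oppr0.
Qed.

Lemma amplitude_node_or_cst (t : R) : (exists i : nat, t = i%:R * h) \/
  exists2 d : R, 0 < d & forall y, `|y - t| < d -> amplitude y = amplitude t.
Proof.
have [t0|t0] := ltP t 0.
  right; exists (- t); first by rewrite oppr_gt0.
  move=> y; rewrite ltr_norml => /andP[_ yt].
  have tr x : x < 0 -> Num.truncn (x / h) = 0%N.
    by move=> x0; apply/truncn0Pn; rewrite -ltNge ltr_pdivrMr//; have := h0; lra.
  by rewrite /amplitude !tr//; lra.
have th0 : 0 <= t / h by rewrite divr_ge0// ltW.
set k := Num.truncn (t / h).
have := truncn_itv th0; rewrite -/k ler_pdivlMr// ltr_pdivrMr// => /andP[kt tk].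
have [->|tn] := eqVneq t (k%:R * h); first by left; exists k.
have {}kt : k%:R * h < t by rewrite lt_neqAle eq_sym tn.
right; exists (Num.min (t - k%:R * h) (k.+1%:R * h - t)).
  by rewrite lt_min !subr_gt0 kt.
move=> y; rewrite lt_min !ltr_norml => /andP[/andP[y1 _] /andP[_ y2]].
rewrite /amplitude -/k; congr a; apply: truncn_def.
by rewrite ler_pdivlMr// ltr_pdivrMr//; apply/andP; split; lra.
Qed.

(** Off the nodes the amplitude is locally constant. At a node [f] vanishes together with its
    derivative, so a bounded factor that jumps does no harm. *)
Lemma amplitude_deriv (f f' : R -> R) :
  (forall t, has_deriv f t (f' t)) -> (forall i : nat, f (i%:R * h) = 0) ->
  (forall i : nat, f' (i%:R * h) = 0) ->
  forall t, has_deriv (fun t => amplitude t * f t) t (amplitude t * f' t).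
Proof.
move=> hf f0 f'0 t; have [[i ->]|[d d0 At]] := amplitude_node_or_cst t; last first.
  apply: (@has_deriv_near _ (fun y => amplitude t * f y) _ _ _ d) => //.
    by move=> y /At ->.
  exact: has_derivZ.
rewrite f'0 mulr0; set x := i%:R * h.
have M0 : 0 < M + 1 by have := le_trans (a0 0%N) (aM 0%N); lra.
apply: has_deriv_eps => e e0; have := hf x; rewrite f'0 => -[dfx dfx0].
move/cvgrPdist_le : dfx; rewrite -/(derive f x 1) dfx0.
move=> /(_ _ (divr_gt0 e0 M0)); rewrite near_withinE => /nbhs_ballP[d /= d0 hd].
exists d => // y yx yd; have yx0 : y - x != 0 by rewrite subr_eq0.
have := hd (y - x); rewrite /ball/= sub0r normrN => /(_ yd yx0).
rewrite sub0r normrN [_ *: 1]mulr1 subrK f0 !subr0 mulr0 subr0.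
rewrite ler_pdivlMr// => hy; apply: le_trans hy.
rewrite -mulrA normrM mulrC [f y / _]mulrC.
apply: ler_wpM2l; first exact: normr_ge0.
by rewrite ger0_norm ?a0// (le_trans (aM _))// lerDl.
Qed.

Lemma amplitude_continuous (g : R -> R) : continuous g ->
  (forall i : nat, g (i%:R * h) = 0) -> continuous (fun t => amplitude t * g t).
Proof.
move=> cg g0 t; have [[i ->]|[d d0 At]] := amplitude_node_or_cst t; last first.
  have c1 : {for t, continuous (fun y => amplitude t * g y)}.
    by apply: cvgM; [exact: cvg_cst|exact: cg].
  move: c1; apply: cvg_trans; apply: near_eq_cvg.
  by apply/nbhs_ballP; exists d => // y; rewrite /ball/= distrC => /At ->.
set x := i%:R * h.
have M0 : 0 < M + 1 by have := le_trans (a0 0%N) (aM 0%N); lra.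
apply/cvgrPdist_le => e e0; rewrite g0 mulr0.
have /cvgrPdist_le/(_ _ (divr_gt0 e0 M0)) := cg x.
apply: filterS => y; rewrite g0 !sub0r !normrN ler_pdivlMr// => hy.
apply: le_trans hy; rewrite normrM mulrC; apply: ler_wpM2l => //.
by rewrite ger0_norm ?a0// (le_trans (aM _))// lerDl.
Qed.

End step_amplitude.

Lemma sin_le1_norm (R : realType) (x : R) : `|sin x| <= 1.
Proof. by rewrite ler_norml sin_geN1 sin_le1. Qed.

Lemma continuous_comp_scale (R : realType) (nu : R) (f : R -> R) : continuous f ->
  continuous (fun t => f (nu * t)).
Proof.
move=> cf t; apply: (@continuous_comp _ _ _ (fun t => nu * t) f); last exact: cf.
by apply: cvgM; [exact: cvg_cst|exact: cvg_id].
Qed.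

Section resonance.
Variables (R : realType) (nu M : R) (a : nat -> R).
Hypotheses (nu0 : 0 < nu) (a0 : forall i, 0 <= a i) (aM : forall i, a i <= M).

Local Notation h := (pi / nu).
Local Notation A := (amplitude nu a).
Local Notation S t := (sin (nu * t)).
Local Notation C t := (cos (nu * t)).

Let M0 : 0 <= M. Proof. exact: le_trans (a0 0%N) (aM 0%N). Qed.

Let cS n : continuous (fun t => S t ^+ n).
Proof.
elim: n => [|n IH] t; first by under eq_fun do rewrite expr0; exact: cvg_cst.
under eq_fun do rewrite exprS; apply: cvgM; last exact: IH.
by apply: continuous_comp_scale; exact: continuous_sin.
Qed.

Let cC : continuous (fun t => C t).
Proof. by apply: continuous_comp_scale; exact: continuous_cos. Qed.

(* If b' = A sin^4 (nu t), then w = sin (nu t) e^b / nu solves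
   w'' = - (nu^2 - osc) w; the fourth power makes osc of class C^1 across the
   nodes, where the step function A jumps. *)
Definition osc (t : R) : R := 6 * nu * (A t * (S t ^+ 3 * C t)) + A t ^+ 2 * S t ^+ 8.

Definition osc' (t : R) : R :=
  6 * nu * (A t * (3 * S t ^+ 2 * (C t * nu) * C t + S t ^+ 3 * (- S t * nu))) +
  A t ^+ 2 * (8 * S t ^+ 7 * (C t * nu)).

Let a20 i : 0 <= a i ^+ 2. Proof. exact: sqr_ge0. Qed.

Let a2M i : a i ^+ 2 <= M ^+ 2.
Proof. by rewrite ler_sqr ?nnegrE. Qed.

Lemma has_deriv_osc t : has_deriv osc t (osc' t).
Proof.
apply: has_derivD.
  apply: has_derivZ; apply: (amplitude_deriv nu0 a0 aM (f' := fun t => 3 * S t ^+ 2 * (C t * nu) * C t + S t ^+ 3 * (- S t * nu))).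
  - by move=> x; apply: has_derivM; [apply: has_derivX; exact: has_deriv_sin|exact: has_deriv_cos].
  - by move=> i; rewrite sin_node// expr0n/= mul0r.
  - by move=> i; rewrite sin_node// !expr0n/= !mulr0 !mul0r addr0.
apply: (amplitude_deriv nu0 a20 a2M (f' := fun t => 8 * S t ^+ 7 * (C t * nu))).
- by move=> x; apply: has_derivX; exact: has_deriv_sin.
- by move=> i; rewrite sin_node// expr0n.
- by move=> i; rewrite sin_node// !expr0n/= !mulr0 !mul0r.
Qed.

Lemma continuous_osc' : continuous osc'.
Proof.
move=> t; apply: cvgD.
  apply: cvgM; first exact: cvg_cst.
  apply: (amplitude_continuous nu0 a0 aM (g := fun t => 3 * S t ^+ 2 * (C t * nu) * C t + S t ^+ 3 * (- S t * nu))).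
    move=> x; apply: cvgD.
      apply: cvgM; last exact: cC.
      apply: cvgM; last by apply: cvgM; [exact: cC|exact: cvg_cst].
      by apply: cvgM; [exact: cvg_cst|exact: cS].
    apply: cvgM; first exact: cS.
    by apply: cvgM; [apply: cvgN; apply: continuous_comp_scale; exact: continuous_sin|exact: cvg_cst].
  by move=> i; rewrite sin_node// !expr0n/= !mulr0 !mul0r addr0.
apply: (amplitude_continuous nu0 a20 a2M (g := fun t => 8 * S t ^+ 7 * (C t * nu))).
  move=> x; apply: cvgM; last by apply: cvgM; [exact: cC|exact: cvg_cst].
  by apply: cvgM; [exact: cvg_cst|exact: cS].
by move=> i; rewrite sin_node// !expr0n/= !mulr0 !mul0r.
Qed.

Lemma osc_bound t : `|osc t| <= 6 * nu * A t + A t ^+ 2.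
Proof.
have At : 0 <= A t by exact: a0.
have s1 n : `|S t ^+ n| <= 1 by rewrite normrX exprn_ile1// sin_le1_norm.
have c1 : `|C t| <= 1 by rewrite ler_norml cos_geN1 cos_le1.
apply: (le_trans (ler_normD _ _)); apply: lerD.
  rewrite normrM ger0_norm ?mulr_ge0 ?(ltW nu0)//.
  apply: ler_wpM2l; first by rewrite mulr_ge0// ltW.
  rewrite normrM ger0_norm// -[leRHS]mulr1; apply: ler_wpM2l => //.
  by rewrite normrM -[leRHS]mulr1; apply: ler_pM.
rewrite normrM ger0_norm ?sqr_ge0// -[leRHS]mulr1.
by apply: ler_wpM2l; [exact: sqr_ge0|exact: s1].
Qed.

Lemma osc'_bound t : `|osc' t| <= 18 * nu ^+ 2 * A t + 8 * nu * A t ^+ 2.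
Proof.
have At : 0 <= A t by exact: a0.
have s1 n : `|S t ^+ n| <= 1 by rewrite normrX exprn_ile1// sin_le1_norm.
have c1 : `|C t| <= 1 by rewrite ler_norml cos_geN1 cos_le1.
have cs := cos2Dsin2 (nu * t).
apply: (le_trans (ler_normD _ _)); apply: lerD.
  (* The last factor is at most 3 in absolute value; hence the constant 18. *)
  rewrite (_ : 6 * nu * _ = 6 * nu ^+ 2 * A t * (3 * S t ^+ 2 * C t ^+ 2 - S t ^+ 4)); last by ring.
  have k0 : 0 <= 6 * nu ^+ 2 * A t by rewrite !mulr_ge0// ltW.
  rewrite normrM ger0_norm// (_ : 18 * nu ^+ 2 * A t = 6 * nu ^+ 2 * A t * 3); last by ring.
  apply: ler_wpM2l => //.
  have -> : C t ^+ 2 = 1 - S t ^+ 2 by rewrite -cs; ring.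
  have -> : S t ^+ 4 = S t ^+ 2 * S t ^+ 2 by ring.
  have := sqr_ge0 (S t); have := sqr_ge0 (C t).
  move: cs; set x := S t ^+ 2; set y := C t ^+ 2 => cs y0 x0.
  by rewrite ler_norml; apply/andP; split; nra.
rewrite (_ : A t ^+ 2 * _ = 8 * nu * A t ^+ 2 * (S t ^+ 7 * C t)); last by ring.
have k0 : 0 <= 8 * nu * A t ^+ 2 by rewrite !mulr_ge0 ?sqr_ge0// ltW.
rewrite normrM ger0_norm// -[leRHS]mulr1; apply: ler_wpM2l => //.
by rewrite normrM -[leRHS]mulr1; apply: ler_pM.
Qed.

(** At the nodes the sine vanishes and the cosine is 1 or -1, so [|w1|] equals [e^b] there. Over a
    half period [b] gains [a i] times the integral of [sin^4], which is [3 / 8 * h]. *)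
Lemma resonant_solution : exists w w1 : R -> R,
  [/\ forall t, has_deriv w t (w1 t),
      forall t, has_deriv w1 t (- (nu ^+ 2 - osc t) * w t), w 0 = 0, w1 0 = 1 &
      forall N : nat, w (N%:R * h) = 0 /\
        `|w1 (N%:R * h)| = expR (\sum_(0 <= i < N) a i * (3 / 8 * h))].
Proof.
have nun0 : nu != 0 by rewrite gt_eqF.
have cAS : continuous (fun t => A t * S t ^+ 4).
  apply: (amplitude_continuous nu0 a0 aM (g := fun t => S t ^+ 4)); first exact: cS.
  by move=> i; rewrite sin_node// expr0n.
have [B hB] := antiderivative cAS.
pose b t := B t - B 0.
have hb t : has_deriv b t (A t * S t ^+ 4).
  by rewrite -[X in has_deriv _ _ X]subr0; apply: has_derivB => //; exact: is_derive_cst.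
have hS5 t : has_deriv (fun t => A t * S t ^+ 5) t (A t * (5 * S t ^+ 4 * (C t * nu))).
  apply: (amplitude_deriv nu0 a0 aM (f' := fun t => 5 * S t ^+ 4 * (C t * nu))).
  - by move=> x; apply: has_derivX; exact: has_deriv_sin.
  - by move=> i; rewrite sin_node// expr0n.
  - by move=> i; rewrite sin_node// !expr0n/= !mulr0 !mul0r.
pose w t := nu^-1 * (S t * expR (b t)).
pose w1 t := nu^-1 * ((nu * C t + A t * S t ^+ 5) * expR (b t)).
have cN (N : nat) : `|C (N%:R * h)| = 1.
  have := cos2Dsin2 (nu * (N%:R * h)); rewrite sin_node// expr0n addr0.
  by move=> c2; rewrite -sqrtr_sqr c2 sqrtr1.
have b0 : b 0 = 0 by rewrite /b subrr.
exists w, w1; split.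
- move=> t; rewrite (_ : w1 t = nu^-1 * (C t * nu * expR (b t) + S t * (expR (b t) * (A t * S t ^+ 4)))).
    by apply: has_derivZ; apply: has_derivM; [exact: has_deriv_sin|exact: has_deriv_expR].
  by rewrite /w1; ring.
- move=> t; rewrite (_ : _ * w t = nu^-1 * ((nu * (- S t * nu) + A t * (5 * S t ^+ 4 * (C t * nu))) *
      expR (b t) + (nu * C t + A t * S t ^+ 5) * (expR (b t) * (A t * S t ^+ 4)))).
    apply: has_derivZ; apply: has_derivM; last exact: has_deriv_expR.
    by apply: has_derivD; [apply: has_derivZ; exact: has_deriv_cos|exact: hS5].
  by rewrite /w /osc; ring.
- by rewrite /w mulr0 sin0 mul0r mulr0.
- by rewrite /w1 mulr0 sin0 cos0 expr0n/= mulr0 addr0 b0 expR0 !mulr1 mulVf.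
move=> N; split; first by rewrite /w sin_node// mul0r mulr0.
rewrite /w1 sin_node// expr0n/= mulr0 addr0 -mulrA mulKf//.
rewrite normrM cN mul1r gtr0_norm ?expR_gt0//; congr expR.
elim: N => [|N IH]; first by rewrite big_geq// mul0r.
rewrite big_nat_recr//= -IH.
(* An explicit primitive of [sin^4 (nu t)]; its periodic terms vanish at the nodes. *)
pose Q t := 3 / 8 * t - S t ^+ 3 * C t / (4 * nu) - 3 * (S t * C t) / (8 * nu).
have hQ t : has_deriv Q t (S t ^+ 4).
  rewrite (_ : S t ^+ 4 = 3 / 8 * 1 - (3 * S t ^+ 2 * (C t * nu) * C t + S t ^+ 3 * (- S t * nu)) / (4 * nu)
     - 3 * (C t * nu * C t + S t * (- S t * nu)) / (8 * nu)); last first.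
    have c2 : C t ^+ 2 = 1 - S t ^+ 2 by have := cos2Dsin2 (nu * t) => <-; ring.
    have -> : 3 * S t ^+ 2 * (C t * nu) * C t = 3 * S t ^+ 2 * nu * C t ^+ 2 by ring.
    have -> : C t * nu * C t = nu * C t ^+ 2 by ring.
    by rewrite c2; field.
  have hSC : has_deriv (fun t => S t * C t) t (C t * nu * C t + S t * (- S t * nu)).
    by apply: has_derivM; [exact: has_deriv_sin|exact: has_deriv_cos].
  apply: has_derivB; last first.
    under [X in has_deriv X]eq_fun do rewrite mulrC.
    by rewrite [X in has_deriv _ _ X]mulrC; apply: has_derivZ; apply: has_derivZ.
  apply: has_derivB; first by apply: has_derivZ; exact: is_derive_id.
  under [X in has_deriv X]eq_fun do rewrite mulrC.
  rewrite [X in has_deriv _ _ X]mulrC; apply: has_derivZ.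
  by apply: has_derivM; [apply: has_derivX; exact: has_deriv_sin|exact: has_deriv_cos].
have h0 : 0 < h by rewrite divr_gt0// pi_gt0.
have hN : N%:R * h < N.+1%:R * h by rewrite ltr_pM2r// ltr_nat.
have cG : {within `[N%:R * h, N.+1%:R * h], continuous (fun t => b t - a N * Q t)}.
  apply: continuous_subspaceT => t; apply: cvgB; first exact: has_deriv_continuous_at (hb t).
  by apply: cvgM; [exact: cvg_cst|exact: has_deriv_continuous_at (hQ t)].
(* The intermediate point is interior, where [A] is the constant [a N]; at the right node it already
   has the next value. *)
have [|x xI] := MVT (df := fun t => A t * S t ^+ 4 - a N * S t ^+ 4) hN _ cG.
  by move=> x _; apply: has_derivB => //; exact: has_derivZ.
have -> : A x = a N.
  rewrite /amplitude; congr a; apply: truncn_def; move: xI; rewrite in_itv/=.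
  by rewrite ler_pdivlMr// ltr_pdivrMr// => /andP[/ltW -> ->].
rewrite subrr mul0r => /eqP; rewrite /Q !sin_node// !expr0n/= !mul0r !mulr0 !mul0r !subr0.
by rewrite -natr1 => /eqP; lra.
Qed.

End resonance.

(** * A discrete form of m *)

Section theta_tail.
Variables (R : realType) (T0 : R) (omega theta : R -> R).
Hypotheses (T00 : 0 < T0) (om : modulus_of_continuity omega)
  (th0 : {in `]0, T0[, forall t, 0 < theta t})
  (thc : {in `]0, T0[, continuous theta})
  (thn : {in `]0, T0[ &, {homo theta : x y /~ x <= y}}).

Let tail (x : R) : \bar R :=
  (\int[@lebesgue_measure R]_(t in (`]x, T0[%classic : set R)) (theta t)%:E)%E.

Let meas (D : set R) : D `<=` (`]0, T0[%classic : set R) ->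
  measurable_fun D (EFin \o theta).
Proof.
move=> D0; apply/measurable_EFinP; apply: (measurable_funS _ D0) => //.
apply: open_continuous_measurable_fun; first exact: interval_open.
by move=> x; rewrite inE/= => /thc.
Qed.

Let theta_ge0 (D : set R) : D `<=` (`]0, T0[%classic : set R) ->
  forall x, D x -> (0 <= (theta x)%:E)%E.
Proof. by move=> D0 x /D0 /th0/ltW; rewrite lee_fin. Qed.

Let piece (x y : R) (D : set R) : measurable D -> 0 < x -> x < y -> y <= T0 ->
  D `<=` (`]0, T0[%classic : set R) -> D `<=` (`]x, y]%classic : set R) ->
  (\int[@lebesgue_measure R]_(t in D) (theta t)%:E <= (theta x * (y - x))%:E)%E.
Proof.
move=> mD x0 xy yT D0 Dxy.
have xI : x \in `]0, T0[ by rewrite in_itv/= x0 (lt_le_trans xy).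
apply: (@le_trans _ _ (\int[@lebesgue_measure R]_(t in D) (cst (theta x)%:E t))%E).
  apply: ge0_le_integral => //; [exact: theta_ge0|exact: meas|].
  move=> z Dz; rewrite lee_fin; apply: thn => //; first exact: D0.
  by have := Dxy _ Dz; rewrite /= in_itv/= => /andP[/ltW].
rewrite integral_cst// EFinM; apply: lee_wpmul2l; first by rewrite lee_fin ltW// th0.
apply: (@le_trans _ _ (@lebesgue_measure R `]x, y]%classic)).
  by apply: le_measure; rewrite ?inE//; exact: measurable_itv.
by rewrite lebesgue_measure_itv/= lte_fin xy -EFinB.
Qed.

Let tail_end (x : R) : 0 < x -> x < T0 -> (tail x <= (theta x * T0)%:E)%E.
Proof.
move=> x0 xT; apply: (@le_trans _ _ (theta x * (T0 - x))%:E); last first.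
  rewrite lee_fin; apply: ler_wpM2l; last by lra.
  by rewrite ltW// th0// in_itv/= x0.
apply: (@piece x T0 _ _ x0 xT) => //.
- by move=> z /=; rewrite !in_itv/= => /andP[xz ->]; rewrite andbT (lt_trans x0).
- by move=> z /=; rewrite !in_itv/= => /andP[-> /ltW].
Qed.

Let tail_step (x y : R) : 0 < x -> x < y -> y < T0 ->
  (tail x <= (theta x * (y - x))%:E + tail y)%E.
Proof.
move=> x0 xy yT.
have E : (`]x, T0[%classic : set R) = `]x, y]%classic `|` `]y, T0[%classic.
  by rewrite -(@itv_bndbnd_setU _ _ _ (BRight y))// bnd_simp ltW.
have s1 : (`]x, y]%classic : set R) `<=` `]0, T0[%classic.
  move=> z /=; rewrite !in_itv/= => /andP[xz zy].
  by rewrite (lt_trans x0 xz) (le_lt_trans zy).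
have s2 : (`]y, T0[%classic : set R) `<=` `]0, T0[%classic.
  by move=> z /=; rewrite !in_itv/= => /andP[yz ->]; rewrite andbT; lra.
have s3 : (`]x, y]%classic : set R) `|` `]y, T0[%classic `<=` `]0, T0[%classic.
  by rewrite subUset.
rewrite /tail E ge0_integral_setU//.
- by rewrite leeD2r//; apply: piece => //; exact: ltW.
- exact: meas.
- exact: theta_ge0.
- rewrite disj_set2E; apply/eqP; rewrite -subset0 => z [] /=.
  rewrite !in_itv/= => /andP[_ zy] /andP[yz _].
  by move: (le_lt_trans zy yz); rewrite ltxx.
Qed.

(* On the nodes where [theta] exceeds [lam * omega (1 / lam)] the modulus is
   the active constraint, afterwards [theta] is: a discrete form of the
   splitting point that realizes the minimum defining [m_lambda]. *)
Lemma m_lambda_grid (lam h : R) (N : nat) :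
  0 < lam -> 0 < h -> (0 < N)%N -> N%:R * h < T0 ->
  m_lambda T0 omega theta lam <= lam * omega (1 / lam) * h +
    \sum_(0 <= i < N) Num.min (lam * omega (1 / lam)) (theta (i.+1%:R * h)) * h +
    theta (N%:R * h) * T0.
Proof.
move=> lam0 h0 N0 NT; set m := m_lambda _ _ _ _; set L := lam * omega (1 / lam).
have [_ _ [_ mle]] := m_lambdaP T00 om th0 thc thn lam0.
have L0 : 0 <= L by rewrite mulr_ge0 ?(ltW lam0)// (modulus_ge0 om)// divr_ge0 ?ltW.
have node i : (0 < i)%N -> (i <= N)%N -> 0 < i%:R * h /\ i%:R * h < T0.
  move=> i0 iN; split; first by rewrite mulr_gt0// ltr0n.
  by apply: le_lt_trans NT; rewrite ler_pM2r// ler_nat.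
have nodeI i : (0 < i)%N -> (i <= N)%N -> i%:R * h \in `]0, T0[.
  by move=> i0 iN; have [h1 h2] := node i i0 iN; rewrite in_itv/= h1.
pose e := theta (N%:R * h) * T0.
have cost i J : (0 < i)%N -> (i <= N)%N -> (tail (i%:R * h) <= J%:E)%E ->
    m <= L * (i%:R * h) + J.
  move=> i0 iN hJ; have := mle (i%:R * h); rewrite -/m => H.
  rewrite -lee_fin EFinD; apply: (le_trans (H _)).
    by have [h1 h2] := node i i0 iN; rewrite in_itv/= !ltW.
  by rewrite /m_cost -/L leeD2l.
(* An upper Riemann sum, since [theta] is nonincreasing; [e] covers everything beyond the last
   node. *)
have tailJ k i : (0 < i)%N -> (i + k = N)%N ->
    (tail (i%:R * h) <= (\sum_(i <= l < N) theta (l%:R * h) * h + e)%:E)%E.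
  elim: k i => [|k IH] i i0 ikN.
    rewrite addn0 in ikN; rewrite ikN big_geq// add0r; have [h1 h2] := node N N0 (leqnn N).
    exact: tail_end.
  have iN : (i < N)%N by rewrite -ikN addnS ltnS leq_addr.
  have [h1 _] := node i i0 (ltnW iN); have [_ h3] := node i.+1 isT iN.
  have h4 : i%:R * h < i.+1%:R * h by rewrite ltr_pM2r// ltr_nat.
  apply: (le_trans (tail_step h1 h4 h3)).
  have -> : i.+1%:R * h - i%:R * h = h by rewrite -natr1; ring.
  rewrite big_ltn// -addrA EFinD; apply: leeD2l.
  by apply: (IH i.+1) => //; rewrite addSnnS.
(* Backward induction on the candidate splitting node. While [theta] is at least [L] the split moves
   one node to the right at cost [L * h]; once [theta] is below [L] it stays below, and the split is
   made there. *)
have key k i : (0 < i)%N -> (i + k = N)%N ->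
    m <= L * (i%:R * h) + (\sum_(i <= l < N) Num.min L (theta (l%:R * h)) * h + e).
  elim: k i => [|k IH] i i0 ikN.
    rewrite addn0 in ikN; apply: cost; rewrite ?ikN// big_geq// add0r.
    have [h1 h2] := node N N0 (leqnn N); exact: tail_end.
  have iN : (i < N)%N by rewrite -ikN addnS ltnS leq_addr.
  have [Lth|thL] := leP L (theta (i%:R * h)).
    have := IH i.+1 isT; rewrite addSnnS => /(_ ikN).
    rewrite [\sum_(i <= l < N) _]big_ltn// min_l// -natr1; set s := \sum_(_ <= l < _) _.
    by move=> hm; apply: (le_trans hm); lra.
  rewrite (@eq_big_nat _ _ _ _ _ _ (fun l => theta (l%:R * h) * h)).
    by apply: cost => //; [exact: ltnW|exact: tailJ ikN].
  move=> l /andP[il lN]; rewrite min_r//; apply: le_trans (ltW thL).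
  apply: thn; first exact: nodeI (leq_trans i0 il) (ltnW lN).
    exact: nodeI i0 (ltnW iN).
  by rewrite ler_pM2r// ler_nat.
have N1 : (1 + N.-1 = N)%N by rewrite add1n prednK.
have := key N.-1 1%N isT N1; rewrite mul1r => hm.
apply: (le_trans hm); rewrite addrA lerD2r lerD2l.
(* The stated sum runs over the nodes 1 to [N], one more than in [key]; the extra term is
   nonnegative. *)
have := big_add1 _ _ 0 N.+1 xpredT (fun i => Num.min L (theta (i%:R * h)) * h) => /= <-.
rewrite big_nat_recr//= lerDl mulr_ge0 ?(ltW h0)//.
by rewrite le_min L0 ltW// th0// nodeI.
Qed.

End theta_tail.

(** * Stability of growth *)

Lemma real_sqr_norm (R : realType) (x : R) : `|x| ^+ 2 = x ^+ 2.
Proof. by rewrite real_normK// num_real. Qed.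

(** Gronwall for the difference of the two solutions. Weight 1 in the energy gives the crude rate
    [lam * |1 - d|], but spares differentiating [d], an arbitrary nearby coefficient. *)
Lemma coefficient_stability (R : realType) (T0 lam K W r tN : R) (c d u u' w w1 : R -> R) :
  0 < lam -> 0 < tN -> tN <= T0 -> 0 <= r -> r <= 1 -> 0 <= W -> 0 < K ->
  solves T0 lam d u u' -> u 0 = w 0 -> u' 0 = w1 0 ->
  (forall x, has_deriv w x (w1 x)) ->
  (forall x, x \in `]0, tN[ -> has_deriv w1 x (- (lam ^+ 2 * c x * w x))) ->
  continuous w1 ->
  (forall x, x \in `]0, tN[ -> `|w x| <= W) ->
  (forall x, x \in `]0, tN[ -> `|d x - c x| <= r) ->
  (forall x, x \in `]0, tN[ -> lam * `|1 - d x| + lam ^+ 2 <= K) ->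
  (u' tN - w1 tN) ^+ 2 <= r * (lam ^+ 2 * W ^+ 2 / K * expR (K * tN)).
Proof.
move=> lam0 tN0 tNT r0 r1 W0 K0 [hu [u'' hu' hode]] uw0 uw1 hw hw1 cw1 wW dc dK.
pose z x := u x - w x; pose z1 x := u' x - w1 x.
(* Adding [k] to the energy turns the forcing term [lam ^ 2 * r * W ^ 2] into [K * k], which makes
   the differential inequality homogeneous. *)
pose k := r * (lam ^+ 2 * W ^+ 2 / K).
have k0 : 0 <= k by rewrite mulr_ge0// divr_ge0 ?(ltW K0)// mulr_ge0 ?sqr_ge0.
pose F x := z1 x ^+ 2 + lam ^+ 2 * z x ^+ 2 + k.
pose F' x := 2 * z1 x ^+ 1 * (u'' x + lam ^+ 2 * c x * w x) +
   lam ^+ 2 * (2 * z x ^+ 1 * z1 x) + 0.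
have sub : (`[0, tN]%classic : set R) `<=` `[0, T0]%classic.
  by move=> x /=; rewrite !in_itv/= => /andP[-> /le_trans]; apply.
have subo x : x \in `]0, tN[ -> x \in `]0, T0[.
  by rewrite !in_itv/= => /andP[-> /lt_le_trans]; apply.
have hF x : x \in `]0, tN[ -> has_deriv F x (F' x).
  move=> xI; have xI' := subo _ xI.
  have dz : has_deriv z x (z1 x) by apply: has_derivB => //; exact: derivative_on_has_deriv hu xI'.
  have dz1 : has_deriv z1 x (u'' x + lam ^+ 2 * c x * w x).
    rewrite -[X in _ + X]opprK; apply: has_derivB; first exact: derivative_on_has_deriv hu' xI'.
    exact: hw1.
  apply: has_derivD; last exact: is_derive_cst.
  by apply: has_derivD; [exact: has_derivX|apply: has_derivZ; exact: has_derivX].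
have cT (f : R -> R) : continuous f -> {within `[0, tN], continuous (fun x => - f x)}.
  by move=> cf; apply: continuous_subspaceT => x; apply: cvgN; exact: cf.
have cz : {within `[0, tN], continuous z}.
  apply: within_continuousD_fun; first exact: continuous_subspaceW sub (derivative_on_continuous hu).
  by apply: cT; exact: has_deriv_continuous hw.
have cz1 : {within `[0, tN], continuous z1}.
  apply: within_continuousD_fun; last exact: cT.
  exact: continuous_subspaceW sub (derivative_on_continuous hu').
have cc (l : R) : {within `[0, tN], continuous (fun=> l)}.
  by apply: continuous_subspaceT => x; exact: cst_continuous.
have cF : {within `[0, tN], continuous F}.
  apply: within_continuousD_fun; last exact: cc.
  apply: within_continuousD_fun; first exact: (within_continuousM_fun cz1 cz1).
  by apply: within_continuousM_fun; [exact: cc|exact: (within_continuousM_fun cz cz)].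
have hK (x : R) : has_deriv (fun x => K * x) x K.
  exact: has_deriv_scale.
have := gronwall (ltW tN0) hF cF hK.
have F0 : F 0 = k by rewrite /F /z /z1 uw0 uw1 !subrr expr0n/= mulr0 !add0r.
rewrite mulr0 subr0 F0 => H.
have {}H : F tN <= k * expR (K * tN).
  apply: H => x xI.
  have uE : u'' x = - (lam ^+ 2 * d x * u x).
    by apply/eqP; rewrite -addr_eq0 hode// subset_itv_oo_cc// subo.
  have -> : F' x = lam * (1 - d x) * (2 * (lam * z x) * z1 x) -
      lam ^+ 2 * (d x - c x) * (2 * w x * z1 x).
    by rewrite /F' uE /z; ring.
  have E1 : `|2 * (lam * z x) * z1 x| <= z1 x ^+ 2 + lam ^+ 2 * z x ^+ 2.
    have := sqr_ge0 (lam * z x - z1 x); have := sqr_ge0 (lam * z x + z1 x).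
    by rewrite ler_norml => *; apply/andP; split; nra.
  have E2 : `|2 * w x * z1 x| <= W ^+ 2 + z1 x ^+ 2.
    have : w x ^+ 2 <= W ^+ 2 by rewrite -[w x ^+ 2]real_sqr_norm ler_sqr ?nnegrE// wW.
    have := sqr_ge0 (w x - z1 x); have := sqr_ge0 (w x + z1 x).
    by rewrite ler_norml => *; apply/andP; split; nra.
  apply: (le_trans (ler_norm _)); apply: (le_trans (ler_normB _ _)).
  have N1 (x1 x2 x3 : R) : 0 < x1 -> `|x1 * x2 * x3| = x1 * `|x2| * `|x3|.
    by move=> x10; rewrite !normrM gtr0_norm.
  rewrite (N1 lam)// (N1 (lam ^+ 2)) ?exprn_gt0//.
  have G1 : lam * `|1 - d x| * `|2 * (lam * z x) * z1 x| <=
      lam * `|1 - d x| * (z1 x ^+ 2 + lam ^+ 2 * z x ^+ 2).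
    by apply: ler_wpM2l => //; rewrite mulr_ge0// ltW.
  have G2 : lam ^+ 2 * `|d x - c x| * `|2 * w x * z1 x| <=
      lam ^+ 2 * r * (W ^+ 2 + z1 x ^+ 2).
    apply: ler_pM => //; first by rewrite mulr_ge0// sqr_ge0.
    by apply: ler_wpM2l; [exact: sqr_ge0|exact: dc].
  apply: (le_trans (lerD G1 G2)).
  have G3 : lam ^+ 2 * r * z1 x ^+ 2 <= lam ^+ 2 * (z1 x ^+ 2 + lam ^+ 2 * z x ^+ 2).
    rewrite -mulrA; apply: ler_wpM2l; first exact: sqr_ge0.
    have := sqr_ge0 (lam * z x); have := sqr_ge0 (z1 x); rewrite exprMn; nra.
  have G4 : (lam * `|1 - d x| + lam ^+ 2) * (z1 x ^+ 2 + lam ^+ 2 * z x ^+ 2) <=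
      K * (z1 x ^+ 2 + lam ^+ 2 * z x ^+ 2).
    apply: ler_wpM2r; last exact: dK.
    by rewrite addr_ge0 ?sqr_ge0// mulr_ge0 ?sqr_ge0.
  have -> : K * F x = K * (z1 x ^+ 2 + lam ^+ 2 * z x ^+ 2) + lam ^+ 2 * r * W ^+ 2.
    by rewrite /F /k; field; rewrite gt_eqF.
  by lra.
rewrite mulrA -/k; apply: le_trans H.
rewrite /F -/(z1 tN) -addrA lerDl addr_ge0// mulr_ge0 ?sqr_ge0//.
Qed.

(** Up to [tN] each solution stays close to [w], so [|u' tN|] is at least half of [expR beta].
    Afterwards the energy can lose at most the last factor, in which 1 pays for the distance to [c]
    and [k * T0 / mu1] for its slope. *)
Lemma robust_growth (R : realType) (T0 mu1 mu2 lam k tN beta : R) (c c' w w1 : R -> R) :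
  0 < mu1 -> mu1 <= mu2 -> 0 < lam -> 0 < tN -> tN < T0 -> 0 <= beta -> 0 <= k ->
  (forall x, has_deriv c x (c' x)) ->
  (forall x, x \in `[0, T0] -> mu1 <= c x <= mu2) ->
  (forall x, x \in `]tN, T0[ -> `|c' x| <= k) ->
  (forall x, has_deriv w x (w1 x)) ->
  (forall x, x \in `]0, tN[ -> has_deriv w1 x (- (lam ^+ 2 * c x * w x))) ->
  continuous w1 -> w 0 = 0 -> w1 0 = 1 -> `|w1 tN| = expR beta ->
  exists2 r, 0 < r & forall d u u' : R -> R,
    (forall x, x \in `[0, T0] -> `|d x - c x| <= r) ->
    solves T0 lam d u u' -> u 0 = 0 -> u' 0 = 1 ->
    forall t, tN <= t -> t <= T0 ->
      Num.min 1 mu1 * (expR (2 * beta) / 4) <=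
      Num.max 1 mu2 * (u' t ^+ 2 + lam ^+ 2 * u t ^+ 2) * expR (1 + k * T0 / mu1).
Proof.
move=> mu10 mu12 lam0 tN0 tNT beta0 k0 hc cmu ck hw hw1 cw1 w00 w10 w1N.
have T00 : 0 < T0 by exact: lt_trans tNT.
have cw : {within `[0, T0], continuous (fun x => `|w x|)}.
  apply: continuous_subspaceT => x.
  by apply: cvg_norm; exact: has_deriv_continuous_at (hw x).
have [xm _ hxm] := EVT_max (ltW T00) cw.
pose W := `|w xm|; pose K := lam * (2 + mu2) + lam ^+ 2.
have mu20 : 0 < mu2 by exact: lt_le_trans mu12.
have K0 : 0 < K by rewrite addr_gt0 ?exprn_gt0// mulr_gt0// addr_gt0.
pose P := lam ^+ 2 * W ^+ 2 / K * expR (K * tN).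
have P0 : 0 <= P.
  by rewrite mulr_ge0 ?expR_ge0// divr_ge0 ?(ltW K0)// mulr_ge0 ?sqr_ge0.
have s0 : 0 < Num.sqrt mu1 by rewrite sqrtr_gt0.
(* The second bound makes the loss from [|d - c|] at most 1 in the exponent; the third gives
   [r * P <= 1 / 4], an error of at most 1/2 at [tN]. *)
pose r := Num.min (Num.min 1 (Num.sqrt mu1 / (lam * T0))) (1 / (4 * (P + 1))).
have P1 : 0 < 4 * (P + 1) by rewrite mulr_gt0// ltr_wpDl.
have r0 : 0 < r.
  have h1 : 0 < Num.sqrt mu1 / (lam * T0) by rewrite divr_gt0// mulr_gt0.
  have h2 : 0 < 1 / (4 * (P + 1)) by rewrite divr_gt0.
  by rewrite !lt_min h1 h2 ltr01.
have : r <= Num.min (Num.min 1 (Num.sqrt mu1 / (lam * T0))) (1 / (4 * (P + 1))) by [].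
rewrite !le_min => /andP[/andP[r1 rs] rP].
exists r => // d u u' dc hu u0 u'0 t tNt tT.
have subo x : x \in `]0, tN[ -> x \in `[0, T0].
  by rewrite !in_itv/= => /andP[/ltW -> /ltW/le_trans]; apply; exact: ltW.
have hz : (u' tN - w1 tN) ^+ 2 <= r * P.
  apply: (@coefficient_stability _ T0 lam K W r tN c d u u' w w1) => //.
  - exact: ltW.
  - exact: ltW.
  - exact: normr_ge0.
  - by rewrite u0 w00.
  - by rewrite u'0 w10.
  - by move=> x xI; apply: hxm; exact: subo.
  - by move=> x xI; apply: dc; exact: subo.
  move=> x xI; rewrite lerD2r; apply: ler_wpM2l; first exact: ltW.
  have := dc _ (subo _ xI); have /andP[] := cmu _ (subo _ xI).
  by rewrite !ler_norml; move: mu10 mu20 r1; clear; lra.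
have rP4 : r * P <= 1 / 4.
  have h1 : r * P <= r * (P + 1) by apply: ler_wpM2l; [exact: ltW|lra].
  by move: rP; rewrite ler_pdivlMr// => h2; lra.
have hu1 : expR (2 * beta) / 4 <= u' tN ^+ 2.
  have eb : 1 <= expR beta by rewrite -expR0 ler_expR.
  have -> : expR (2 * beta) = expR beta ^+ 2 by rewrite mulr_natl mulr2n expRD.
  have : `|u' tN - w1 tN| <= 1 / 2.
    by rewrite -ler_sqr ?nnegrE// real_sqr_norm; lra.
  move=> h2.
  rewrite -[u' tN ^+ 2]real_sqr_norm.
  have h3 : expR beta / 2 <= `|u' tN| by have := ler_dist_dist (u' tN) (w1 tN); rewrite w1N ler_norml; lra.
  have -> : expR beta ^+ 2 / 4 = (expR beta / 2) ^+ 2 by field.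
  by rewrite ler_sqr ?nnegrE//; lra.
have hK (x : R) : has_deriv (fun x => k * x) x k.
  exact: has_deriv_scale.
have subt x : x \in `]tN, t[ -> x \in `[0, T0].
  by rewrite !in_itv/=; move: tN0 tT; clear; lra.
(* The smooth [c] is the weight of the energy here, while [u] solves the equation with [d]. *)
have [|||_ h] := energy_gronwall lam0 mu10 (ltW tN0) tNt tT hu hc hK (eps := r).
- by move=> x /subt /cmu /andP[].
- by move=> x /subt /dc; rewrite distrC.
- move=> x xI; apply: ck; move: xI; rewrite !in_itv/= => /andP[-> ?]; lra.
have tNI : tN \in `[0, T0] by rewrite in_itv/=; apply/andP; split; exact: ltW.
have tI : t \in `[0, T0] by rewrite in_itv/= tT andbT; lra.
have [h1 _] := energy_equiv lam (u t) (u' t) (cmu _ tI).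
have [_ h2] := energy_equiv lam (u tN) (u' tN) (cmu _ tNI).
have mn0 : 0 < Num.min 1 mu1 by rewrite lt_min ltr01.
apply: (@le_trans _ _ (Num.min 1 mu1 * (u' tN ^+ 2 + lam ^+ 2 * u tN ^+ 2))).
  apply: ler_wpM2l; first exact: ltW.
  by apply: (le_trans hu1); rewrite lerDl mulr_ge0 ?sqr_ge0.
apply: (le_trans h2); apply: (le_trans h).
apply: ler_pM; [|exact: expR_ge0|exact: h1|].
  rewrite addr_ge0 ?sqr_ge0// mulr_ge0 ?sqr_ge0// mulr_ge0 ?sqr_ge0//.
  by have /andP[+ _] := cmu _ tI; apply: le_trans; exact: ltW.
rewrite ler_expR; apply: lerD.
  move: rs; rewrite ler_pdivlMr ?mulr_gt0// => rs.
  rewrite mulrAC ler_pdivrMr// mul1r; apply: le_trans rs.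
  rewrite [lam * r]mulrC -mulrA; apply: ler_wpM2l; first exact: ltW.
  by apply: ler_wpM2l; [exact: ltW|lra].
apply: ler_wpM2r; first by rewrite invr_ge0 ltW.
rewrite -mulrBr; apply: ler_wpM2l => //; lra.
Qed.

(** * Construction of the coefficient *)

(** A convex combination with the midpoint of the bounds creates the slack [eta], freezing left of
    [del] the constant part, averaging the smoothness. The window [del / 2] looks to the right, so
    constancy remains up to [del / 2]. *)
Lemma background (R : realType) (T0 mu1 mu2 e0 tau : R) (omega theta c0 : R -> R) :
  0 < T0 -> 0 < mu1 -> mu1 < mu2 -> modulus_of_continuity omega ->
  {in `]0, T0[, forall t, 0 < theta t} ->
  {in `]0, T0[ &, {homo theta : x y /~ x <= y}} ->
  in_PS T0 mu1 mu2 omega theta c0 -> 0 < e0 -> 0 < tau ->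
  exists eta del : R, exists g g' : R -> R,
    [/\ 0 < eta, 0 < del, del <= T0 / 2 & del <= tau] /\
    [/\ forall x, has_deriv g x (g' x), continuous g',
        forall x, mu1 + eta * (mu2 - mu1) / 2 <= g x <= mu2 - eta * (mu2 - mu1) / 2,
        forall x y, `|g x - g y| <= (1 - eta) * omega `|x - y| &
        forall x, x \in `]0, T0[ -> `|g' x| <= theta x] /\
    [/\ forall x, x <= del / 2 -> g x = g 0, forall x, x <= del / 2 -> g' x = 0 &
        forall x, x \in `[0, T0] -> `|g x - c0 x| <= e0 / 2].
Proof.
move=> T00 mu10 mu12 om th0 thn hc0 e00 tau0; have [_ cmu com _] := hc0.
have dmu : 0 < mu2 - mu1 by rewrite subr_gt0.
pose eta := Num.min (1 / 2) (e0 / (4 * (mu2 - mu1))).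
have eta0 : 0 < eta.
  have h1 : 0 < e0 / (4 * (mu2 - mu1)) by rewrite divr_gt0// mulr_gt0.
  by rewrite lt_min h1 divr_gt0.
have : eta <= Num.min (1 / 2) (e0 / (4 * (mu2 - mu1))) by [].
rewrite le_min => /andP[eta2 etae].
have {}etae : eta * (mu2 - mu1) <= e0 / 4.
  by move: etae; rewrite ler_pdivlMr ?mulr_gt0//; lra.
have [d1 d10 hd1] := omega_small om (divr_gt0 e00 (ltr0n R 8)).
pose del := Num.min (Num.min d1 (T0 / 2)) tau.
have del0 : 0 < del.
  have h1 : 0 < T0 / 2 by rewrite divr_gt0.
  by rewrite !lt_min d10 h1.
have : del <= Num.min (Num.min d1 (T0 / 2)) tau by [].
rewrite !le_min => /andP[/andP[deld1 delT] deltau].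
have delT0 : 0 <= del <= T0 by apply/andP; split; lra.
have dT : del <= T0 by lra.
have [cf fmu fom] := PS_clamp om hc0 delT0.
pose f x := (1 - eta) * c0 (clamp del T0 x) + eta * ((mu1 + mu2) / 2).
have cff : continuous f.
  move=> x; apply: cvgD; last exact: cvg_cst.
  by apply: cvgM; [exact: cvg_cst|exact: cf].
have fB x y : f x - f y = (1 - eta) * (c0 (clamp del T0 x) - c0 (clamp del T0 y)).
  by rewrite /f; ring.
have eta1 : 0 <= 1 - eta by lra.
have ffom x y : `|f x - f y| <= (1 - eta) * omega `|x - y|.
  by rewrite fB normrM ger0_norm//; apply: ler_wpM2l.
have ffom1 x y : `|f x - f y| <= omega `|x - y|.
  apply: (le_trans (ffom x y)); have := modulus_ge0 om (normr_ge0 (x - y)).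
  by move=> h; nra.
have ffmu x : mu1 + eta * (mu2 - mu1) / 2 <= f x <= mu2 - eta * (mu2 - mu1) / 2.
  by rewrite /f; have /andP[h1 h2] := fmu x; apply/andP; split; nra.
pose e := del / 2; have e0' : 0 < e by rewrite divr_gt0.
have [g [dg gmu gf gg]] := mollify_modulus e0' om cff ffmu ffom1.
exists eta, del, g, (fun x => (f (x + e) - f x) / e).
have g'0 x : x <= del / 2 -> (f (x + e) - f x) / e = 0.
  move=> xd; rewrite fB /clamp !max_r ?subrr ?mulr0 ?mul0r//; rewrite /e; move: xd del0; clear; lra.
split; first by split.
split; split=> //.
- move=> x; apply: cvgM; last exact: cvg_cst.
  apply: cvgB; last exact: cff.
  apply: (@continuous_comp _ _ _ (fun x => x + e) f); last exact: cff.
  by apply: cvgD; [exact: cvg_id|exact: cvg_cst].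
- move=> x y; have [r ->] := gg x y; apply: (le_trans (ffom _ _)).
  by rewrite (_ : x + r - (y + r) = x - y)//; ring.
- move=> x xI; have := xI; rewrite in_itv/= => /andP[x0 xT].
  rewrite normrM (ger0_norm (_ : 0 <= e^-1)); last by rewrite invr_ge0 ltW.
  rewrite ler_pdivrMr// fB normrM ger0_norm//.
  have thx := th0 _ xI.
  have xe : x <= x + e by rewrite lerDl ltW.
  have zy := clamp_homo del T0 xe.
  have yz : clamp del T0 (x + e) - clamp del T0 x <= e.
    have := clamp_lip (x + e) x dT.
    by rewrite addrAC subrr add0r (gtr0_norm e0') ger0_norm ?subr_ge0.
  have /andP[z1 z2] := clamp_itv x dT.
  have /andP[y1 y2] := clamp_itv (x + e) dT.
  have xz : x <= clamp del T0 x.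
    by rewrite /clamp le_min le_max lexx/= ltW.
  (* Freezing moves points to the right only, where [theta] is smaller, and never increases
     distances. *)
  have H : `|c0 (clamp del T0 (x + e)) - c0 (clamp del T0 x)| <= theta x * e.
    have [E|zny] := eqVneq (clamp del T0 (x + e)) (clamp del T0 x).
      by rewrite E subrr normr0 mulr_ge0 ?ltW.
    have {zy} zy : clamp del T0 x < clamp del T0 (x + e) by rewrite lt_neqAle eq_sym zny.
    have zI : clamp del T0 x \in `]0, T0[.
      by rewrite in_itv/= (lt_le_trans del0 z1) (lt_le_trans zy).
    have := PS_lipschitz T00 om th0 thn hc0 (lt_le_trans del0 z1) zy y2.
    move=> /le_trans; apply; apply: ler_pM => //; first exact: ltW (th0 _ zI).
    - by rewrite subr_ge0 ltW.
    - exact: thn.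
  by apply: le_trans H; rewrite ler_piMl//; move: eta0; clear; lra.
- move=> x xd; apply: (@deriv0_cst _ g) => y yx; rewrite -(g'0 y); first exact: dg.
  by case/orP: yx => /andP[]; move: xd del0; clear; lra.
move=> x xI; have := xI; rewrite in_itv/= => /andP[x0 xT].
have h1 : `|g x - f x| <= e0 / 8.
  by apply: (le_trans (gf x)); apply: hd1 => //; rewrite /e; lra.
have h2 : `|c0 (clamp del T0 x) - c0 x| <= e0 / 8.
  have [xd|dx] := leP del x; first by rewrite clamp_id ?xd// subrr normr0 divr_ge0 ?ltW.
  have -> : clamp del T0 x = del by rewrite /clamp max_r ?ltW// min_l.
  apply: (le_trans (com _ _ _ _)) => //.
  by rewrite gtr0_norm ?subr_gt0//; apply: hd1; move: dx x0 deld1; clear; lra.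
have h3 : `|c0 x - (mu1 + mu2) / 2| <= mu2 - mu1.
  by have /andP[] := cmu x xI; rewrite ler_norml; move: dmu; clear; lra.
(* Averaging and freezing cost [e0 / 8] each, the shift to the midpoint [e0 / 4]. *)
have -> : g x - c0 x = (g x - f x) + ((1 - eta) * (c0 (clamp del T0 x) - c0 x)
    - eta * (c0 x - (mu1 + mu2) / 2)) by rewrite /f; ring.
apply: (le_trans (ler_normD _ _)).
have h4 : `|(1 - eta) * (c0 (clamp del T0 x) - c0 x)| <= e0 / 8.
  by rewrite normrM ger0_norm//; apply: le_trans h2; rewrite ler_piMl//; move: eta0; clear; lra.
have h5 : `|eta * (c0 x - (mu1 + mu2) / 2)| <= e0 / 4.
  by rewrite normrM gtr0_norm//; apply: le_trans etae; rewrite ler_pM2l.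
have := ler_normB ((1 - eta) * (c0 (clamp del T0 x) - c0 x)) (eta * (c0 x - (mu1 + mu2) / 2)).
by move: h1 h4 h5; clear; lra.
Qed.

(** The oscillation [p] has size at most [w / 4] and slope at most [A / kap], that is, at most both
    [lam * w] and [theta]. It lives where [g] is constant, so its slope has no competitor there. *)
Lemma perturbation (R : realType) (T0 mu1 mu2 eta del gam lam kap e0 : R) (N : nat)
    (omega theta g g' : R -> R) :
  let w := omega (1 / lam) in let nu := gam * lam in let h := pi / nu in
  let a i := if (i < N)%N then kap * Num.min (lam * w) (theta (i.+1%:R * h)) else 0 in
  modulus_of_continuity omega ->
  {in `]0, T0[, forall t, 0 < theta t} ->
  {in `]0, T0[ &, {homo theta : x y /~ x <= y}} ->
  mu1 < mu2 -> 0 < eta -> 0 < del -> del <= T0 / 2 -> 0 < gam -> 0 < lam -> 0 < kap ->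
  0 < e0 ->
  (forall x, has_deriv g x (g' x)) -> continuous g' ->
  (forall x, mu1 + eta * (mu2 - mu1) / 2 <= g x <= mu2 - eta * (mu2 - mu1) / 2) ->
  (forall x y, `|g x - g y| <= (1 - eta) * omega `|x - y|) ->
  (forall x, x \in `]0, T0[ -> `|g' x| <= theta x) ->
  (forall x, x <= del / 2 -> g x = g 0) -> (forall x, x <= del / 2 -> g' x = 0) ->
  32 * (gam * kap) <= 1 -> 32 * (gam ^+ 2 * kap) <= 1 ->
  16 * (kap ^+ 2 * w) <= 1 -> kap * w <= 1 -> w <= e0 -> w <= eta * (mu2 - mu1) ->
  w <= eta * omega (del / 4) -> N%:R * h <= del / 4 ->
  exists c c' : R -> R, [/\ forall x, has_deriv c x (c' x), continuous c',
     forall x, mu1 <= c x <= mu2, forall x, `|c x - g x| <= e0 / 4 &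
     forall x, x \in `]0, T0[ -> `|c' x| <= theta x] /\
     (forall x, c x = g x - osc nu a x / lam ^+ 2) /\
     (forall x y, x \in `[0, T0] -> y \in `[0, T0] -> `|c x - c y| <= omega `|x - y|).
Proof.
move=> w nu h a om th0 thn mu12 eta0 del0 delT gam0 lam0 kap0 e00.
move=> dg cg' gmu gom gth g0 g'0 gk g2k kw1 kw2 we wmu wdel Nh.
have il : 0 < 1 / lam by rewrite divr_gt0.
have w0 : 0 < w by exact: modulus_gt0.
have nu0 : 0 < nu by rewrite mulr_gt0.
have h0 : 0 < h by rewrite divr_gt0// pi_gt0.
have nodeI i : (i < N)%N -> i.+1%:R * h \in `]0, T0[.
  move=> iN; rewrite in_itv/= mulr_gt0 ?ltr0n//=.
  have : i.+1%:R * h <= N%:R * h by rewrite ler_pM2r// ler_nat.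
  by lra.
have a0 i : 0 <= a i.
  rewrite /a; case: ifP => // iN; rewrite mulr_ge0 ?(ltW kap0)// le_min.
  by rewrite mulr_ge0 ?(ltW w0) ?(ltW lam0)//= ltW// th0// nodeI.
have aM i : a i <= kap * (lam * w).
  rewrite /a; case: ifP => _; last by rewrite !mulr_ge0// ltW.
  by rewrite ler_pM2l// ge_min lexx.
pose A := amplitude nu a.
have A0 x : 0 <= A x by exact: a0.
have AM x : A x <= kap * (lam * w) by exact: aM.
have Az x : N%:R * h <= x -> A x = 0.
  move=> Nx; rewrite /A /amplitude /a ifF//; apply: negbTE; rewrite -leqNgt.
  have x0 : 0 <= x by apply: le_trans Nx; rewrite mulr_ge0 ?ler0n// ltW.
  by rewrite truncn_ge_nat; [rewrite ler_pdivlMr|rewrite divr_ge0// ltW].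
have Ath x : x \in `]0, T0[ -> A x <= kap * theta x.
  move=> xI; have thx := th0 _ xI; rewrite /A /amplitude /a; case: ifP => iN; last first.
    by rewrite mulr_ge0// ltW.
  (* Sampling [theta] at the right end of the half period gives a value below [theta x] and avoids
     the point 0. *)
  rewrite ler_pM2l// ge_min; apply/orP; right; apply: thn => //; first exact: nodeI.
  by rewrite -ler_pdivrMr// ltW// truncnS_gt.
pose p x := - (osc nu a x / lam ^+ 2).
pose p' x := - (osc' nu a x / lam ^+ 2).
have l2 : 0 < lam ^+ 2 by rewrite exprn_gt0.
have dp x : has_deriv p x (p' x).
  have -> : p = fun x => - lam ^- 2 * osc nu a x by apply/funext => y; rewrite /p mulrC mulNr.
  by rewrite /p' mulrC -mulNr; apply: has_derivZ; exact: has_deriv_osc nu0 a0 aM x.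
have cp' : continuous p'.
  move=> x; apply: cvgN; apply: cvgM; last exact: cvg_cst.
  exact: continuous_osc' nu0 a0 aM x.
have pw x : `|p x| <= w / 4.
  have pA : `|p x| <= 6 * gam * (A x / lam) + (A x / lam) ^+ 2.
    rewrite /p normrN normrM (gtr0_norm (_ : 0 < lam ^- 2)) ?invr_gt0// ler_pdivrMr//.
    apply: (le_trans (osc_bound nu0 a0 x)); rewrite -/A le_eqVlt; apply/orP; left.
    by apply/eqP; rewrite /nu; field; rewrite gt_eqF.
  apply: (le_trans pA).
  have AL : A x / lam <= kap * w by rewrite ler_pdivrMr// mulrAC -mulrA AM.
  have AL0 : 0 <= A x / lam by rewrite divr_ge0// ltW.
  have h1 : 6 * gam * (A x / lam) <= 6 * gam * (kap * w).
    by rewrite ler_pM2l// mulr_gt0.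
  have h2 : (A x / lam) ^+ 2 <= (kap * w) ^+ 2 by rewrite ler_sqr ?nnegrE// mulr_ge0 ?ltW.
  (* The two terms contribute at most [6 / 32] and [1 / 16] of [w], in total [w / 4]. *)
  have h3 : 32 * (gam * kap) * w <= 1 * w by rewrite ler_pM2r.
  have h4 : 16 * (kap ^+ 2 * w) * w <= 1 * w by rewrite ler_pM2r.
  by rewrite exprMn in h2; lra.
have p'A x : kap * `|p' x| <= A x.
  have pA : `|p' x| <= 18 * gam ^+ 2 * A x + 8 * gam * (A x * (A x / lam)).
    rewrite /p' normrN normrM (gtr0_norm (_ : 0 < lam ^- 2)) ?invr_gt0// ler_pdivrMr//.
    apply: (le_trans (osc'_bound nu0 a0 x)); rewrite -/A le_eqVlt; apply/orP; left.
    by apply/eqP; rewrite /nu; field; rewrite gt_eqF.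
  have AL : A x / lam <= kap * w by rewrite ler_pdivrMr// mulrAC -mulrA AM.
  have h1 : A x * (A x / lam) <= A x * (kap * w) by apply: ler_wpM2l.
  have h2 : kap * `|p' x| <= kap * (18 * gam ^+ 2 * A x + 8 * gam * (A x * (kap * w))).
    rewrite ler_pM2l//; apply: (le_trans pA); rewrite lerD2l ler_pM2l//.
    by rewrite mulr_gt0.
  apply: (le_trans h2).
  have h3 : 32 * (gam ^+ 2 * kap) * A x <= 1 * A x by apply: ler_wpM2r.
  have h4 : 32 * (gam * kap) * (kap * w) <= 1 * 1 by apply: ler_pM => //; rewrite !mulr_ge0// ltW.
  have h5 : 32 * (gam * kap) * (kap * w) * A x <= 1 * 1 * A x by apply: ler_wpM2r.
  by have := A0 x; lra.
have pz x : N%:R * h <= x -> p x = 0.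
  move=> /Az Ax0; have := osc_bound nu0 a0 x; rewrite -/A Ax0 mulr0 expr0n addr0 normr_le0.
  by move=> /eqP ox; rewrite /p ox mul0r oppr0.
have p'z x : N%:R * h <= x -> p' x = 0.
  move=> /Az Ax0; have := osc'_bound nu0 a0 x; rewrite -/A Ax0 !mulr0 expr0n mulr0 addr0 normr_le0.
  by move=> /eqP ox; rewrite /p' ox mul0r oppr0.
exists (fun x => g x + p x), (fun x => g' x + p' x); split.
  split.
  - by move=> x; exact: has_derivD.
  - by move=> x; apply: cvgD; [exact: cg'|exact: cp'].
  - move=> x; have /andP[g1 g2] := gmu x; have := pw x; rewrite ler_norml => /andP[p1 p2].
    by move: g1 g2 p1 p2 wmu w0; clear; lra.
  - by move=> x; rewrite addrAC subrr add0r; apply: (le_trans (pw x)); lra.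
  move=> x xI; have [xN|Nx] := ltP x (N%:R * h); last by rewrite p'z// addr0 gth.
  rewrite g'0 ?add0r; last by lra.
  by rewrite -(ler_pM2l kap0); apply: (le_trans (p'A x)); exact: Ath.
split; first by [].
move=> x y; wlog xy : x y / x <= y => [wh xI yI|].
  have [xy|/ltW yx] := leP x y; first exact: wh.
  by rewrite distrC [`|x - y|]distrC; exact: wh.
rewrite !in_itv/= => /andP[x0 xT] /andP[y0 yT].
rewrite [`|x - y|]distrC (ger0_norm (_ : 0 <= y - x)) ?subr_ge0//.
move: xy; rewrite le_eqVlt => /predU1P[->|xy].
  by rewrite !subrr normr0 (modulus_ge0 om).
have yx0 : 0 < y - x by rewrite subr_gt0.
have gxy : `|g x - g y| <= (1 - eta) * omega (y - x).
  by have := gom x y; rewrite [`|x - y|]distrC (gtr0_norm yx0).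
have oyx : 0 < omega (y - x) by exact: modulus_gt0.
have -> : g x + p x - (g y + p y) = (g x - g y) + (p x - p y) by ring.
have [yd|dy] := leP y (del / 2).
  have xd : x <= del / 2 by lra.
  rewrite (g0 x xd) (g0 y yd) subrr add0r.
  (* Up to distance [1 / lam] the slope [lam * w] is admissible because [sigma / omega sigma] is
     nondecreasing; beyond it, [omega] is at least [w] and the size of [p] suffices. *)
  have [yl|ly] := leP (y - x) (1 / lam).
    have h1 : `|p y - p x| <= lam * w * y - lam * w * x.
      apply: (@deriv_le_diff _ p p' (fun x => lam * w * x) (fun=> lam * w)) => //.
      - exact: ltW.
      - move=> z _; exact: has_deriv_scale.
      - by move=> z _; rewrite -(ler_pM2l kap0); apply: (le_trans (p'A z)).
    rewrite distrC; apply: (le_trans h1); rewrite -mulrBr.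
    have := modulus_ratio_nondecreasing om; move=> /(_ (y - x) (1 / lam)).
    rewrite !in_itv/= !andbT => /(_ yx0 il yl).
    rewrite -/w ler_pdivrMr// mulrAC ler_pdivlMr// => h2.
    rewrite -mulrA [w * _]mulrC -(ler_pM2l il) mulrA div1r mulVf ?gt_eqF// mul1r.
    by move: h2; rewrite div1r.
  have h1 := pw x; have h2 := pw y.
  have h3 : w <= omega (y - x).
    by apply: (modulus_nondecreasing om); rewrite ?in_itv/= ?andbT ?ltW.
  by apply: (le_trans (ler_normB _ _)); lra.
(* Either [p] vanishes at both points, or they are more than [del / 4] apart and the slack [eta]
   pays for [p x]. *)
have py : p y = 0 by apply: pz; lra.
rewrite py subr0; apply: (le_trans (ler_normD _ _)).
have [xd|dx] := leP (del / 4) x.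
  have px : p x = 0 by apply: pz; lra.
  rewrite px normr0 addr0; apply: (le_trans gxy).
  by rewrite ler_piMl ?ltW//; move: eta0; clear; lra.
have h1 : omega (del / 4) <= omega (y - x).
  apply: (modulus_nondecreasing om); rewrite ?in_itv/= ?andbT;
    by move: dy dx del0; clear; lra.
have h2 : eta * omega (del / 4) <= eta * omega (y - x) by rewrite ler_pM2l.
by have := pw x; move: h2 gxy wdel w0; clear; lra.
Qed.

(** * Density and residuality *)

(** The index [n] is chosen after [del]: all losses depend on the background alone, so a large
    m(lambda) absorbs them. As [del <= tau], the growth is complete before [tau]. *)
Lemma dense_growth (R : realType) (T0 mu1 mu2 e0 tau : R) (omega theta c0 : R -> R)
    (lam : nat -> R) (k : nat) :
  let m := m_lambda T0 omega theta in
  let M3 := 1 / (128 * mu2) * Num.min 1 (Num.sqrt mu1 / pi) in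
  0 < T0 -> 0 < mu1 -> mu1 < mu2 -> modulus_of_continuity omega ->
  {in `]0, T0[, forall t, 0 < theta t} ->
  {in `]0, T0[, continuous theta} ->
  {in `]0, T0[ &, {homo theta : x y /~ x <= y}} ->
  m l @[l --> +oo] --> +oo -> (forall n, 0 < lam n) -> lam n @[n --> \oo] --> +oo ->
  in_PS T0 mu1 mu2 omega theta c0 -> 0 < e0 -> 0 < tau ->
  exists c : R -> R, [/\ in_PS T0 mu1 mu2 omega theta c,
    forall x, x \in `[0, T0] -> `|c x - c0 x| <= e0 * (3 / 4) &
    exists2 n, (k <= n)%N & exists2 r, 0 < r & forall d u u' : R -> R,
      (forall x, x \in `[0, T0] -> `|d x - c x| <= r) ->
      solves T0 (lam n) d u u' -> u 0 = 0 -> u' 0 = 1 ->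
      forall t, tau <= t -> t <= T0 ->
        1 <= (u' t ^+ 2 + lam n ^+ 2 * u t ^+ 2) * expR (- M3 * m (lam n))].
Proof.
move=> m M3 T00 mu10 mu12 om th0 thc thn mcvg lam0 lamcvg hc0 e00 tau0.
have mu20 : 0 < mu2 by exact: lt_trans mu12.
have s10 : 0 < Num.sqrt mu1 by rewrite sqrtr_gt0.
have [eta [del [g [g' [[eta0 del0 delT deltau] [[dg cg' gmu gom gth] [g0 g'0 gc0]]]]]]] :=
  background T00 mu10 mu12 om th0 thn hc0 e00 tau0.
pose gam := Num.sqrt (g 0).
have gmu' x : mu1 <= g x <= mu2.
  have /andP[h1 h2] := gmu x; have h3 : 0 < eta * (mu2 - mu1) by rewrite mulr_gt0// subr_gt0.
  by apply/andP; split; lra.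
have /andP[g01 g02] := gmu' 0.
have gpos : 0 < g 0 by exact: lt_le_trans g01.
have gam0 : 0 < gam by rewrite sqrtr_gt0.
have gam2 : gam ^+ 2 = g 0 by rewrite sqr_sqrtr// ltW.
(* Small enough for the oscillation to respect omega and theta, large enough
   for the growth rate 3/4 * kap to exceed M3. *)
pose kap := Num.min 1 (Num.sqrt mu1) / (32 * mu2).
have mu32 : 0 < 32 * mu2 by rewrite mulr_gt0.
have kap0 : 0 < kap by rewrite divr_gt0// lt_min ltr01.
have kapE : 32 * mu2 * kap = Num.min 1 (Num.sqrt mu1).
  by rewrite mulrC divfK// gt_eqF.
have gs : gam * Num.sqrt mu1 <= mu2.
  have : gam * Num.sqrt mu1 <= gam * gam by rewrite ler_pM2l// /gam ler_wsqrtr.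
  by rewrite -expr2 gam2; lra.
have [min1 mins] : Num.min 1 (Num.sqrt mu1) <= 1 /\
    Num.min 1 (Num.sqrt mu1) <= Num.sqrt mu1.
  by rewrite !ge_min !lexx orbT.
have gk : 32 * (gam * kap) <= 1.
  rewrite -(ler_pM2l mu20) mulr1.
  have -> : mu2 * (32 * (gam * kap)) = gam * (32 * mu2 * kap) by ring.
  rewrite kapE.
  by apply: le_trans gs; rewrite ler_pM2l.
have g2k : 32 * (gam ^+ 2 * kap) <= 1.
  rewrite -(ler_pM2l mu20) mulr1.
  have -> : mu2 * (32 * (gam ^+ 2 * kap)) = gam ^+ 2 * (32 * mu2 * kap) by ring.
  rewrite kapE gam2; apply: le_trans g02; rewrite ler_piMr// ltW//.
have M30 : 0 < M3.
  by rewrite mulr_gt0 ?divr_gt0 ?mulr_gt0// lt_min ltr01 divr_gt0// pi_gt0.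
have M3kap : 4 * M3 <= kap.
  rewrite /M3 /kap ler_pdivlMr//.
  set y := Num.min 1 (Num.sqrt mu1 / pi).
  have -> : 4 * (1 / (128 * mu2) * y) * (32 * mu2) = y by field; rewrite gt_eqF.
  rewrite /y.
  rewrite le_min !ge_min lexx/=; apply/orP; right.
  by rewrite ler_pdivrMr ?pi_gt0// ler_peMr ?(ltW s10)//; have := @pi_ge2 R; lra.
clearbody kap M3.
pose th := theta (del / 8).
have dI : del / 8 \in `]0, T0[ by rewrite in_itv/=; apply/andP; split; lra.
have thpos : 0 < th by exact: th0.
set mx := Num.max 1 mu2; set mn := Num.min 1 mu1.
have mx1 : 1 <= mx by rewrite le_max lexx.
have mx0 : 0 < mx by lra.
have mn0 : 0 < mn by rewrite lt_min ltr01.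
pose D0 := ln (4 * mx / mn).
have D0E : expR D0 = 4 * mx / mn by rewrite lnK// posrE divr_gt0// mulr_gt0.
(* The losses from discretizing m, from the passage to later times, and from comparing energies. *)
pose C3 := 3 / 4 * kap * (1 + th * T0) + (1 + th * T0 / mu1) + D0.
(* All smallness conditions of [perturbation] on [w]; the last entry [gam / pi] bounds the first
   grid term [l * w * h] by 1. *)
pose q := Num.min (Num.min (1 / (16 * kap ^+ 2)) (1 / kap))
  (Num.min (Num.min e0 (eta * (mu2 - mu1))) (Num.min (eta * omega (del / 4)) (gam / pi))).
have q0 : 0 < q.
  have o0 : 0 < omega (del / 4) by apply: (modulus_gt0 om); rewrite divr_gt0.
  have q1 : 0 < 1 / (16 * kap ^+ 2) by apply: divr_gt0 => //; apply: mulr_gt0 => //; exact: exprn_gt0.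
  have q2 : 0 < 1 / kap by rewrite divr_gt0.
  have q3 : 0 < eta * (mu2 - mu1) by rewrite mulr_gt0 ?subr_gt0.
  have q4 : 0 < eta * omega (del / 4) by rewrite mulr_gt0.
  have q5 : 0 < gam / pi by rewrite divr_gt0 ?pi_gt0.
  by rewrite !lt_min q1 q2 q3 q4 q5 e00.
have [d1 d10 hd1] := omega_small om q0.
(* The first bound yields [w <= q], the second [h <= del / 8], which puts the last node between
   [del / 8] and [del / 4]. *)
pose lam1 := Num.max (1 / d1) (8 * pi / (gam * del)).
have [n kn [lamn mn_]] : exists2 n, (k <= n)%N & lam1 <= lam n /\ C3 / (2 * M3) <= m (lam n).
  have mcv : m (lam n) @[n --> \oo] --> +oo by exact: (cvg_comp lam m lamcvg mcvg).
  move/cvgryPge : (lamcvg) => /(_ lam1) hl; move/cvgryPge : mcv => /(_ (C3 / (2 * M3))) hm.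
  have [N _ hN] : \forall n \near \oo, [/\ (k <= n)%N, lam1 <= lam n & C3 / (2 * M3) <= m (lam n)].
    near=> n; split; [|by near: n|by near: n].
    by near: n; exact: nbhs_infty_ge.
  by have [h1 h2 h3] := hN N (leqnn N); exists N.
set l := lam n in lamn mn_ *; have l0 : 0 < l by exact: lam0.
move: lamn; rewrite ge_max => /andP[ld1 lpi].
set w := omega (1 / l).
have wq : w <= q.
  apply: hd1; first by rewrite divr_gt0.
  by rewrite ler_pdivrMr// mulrC -ler_pdivrMr.
move: (wq); rewrite !le_min.
move=> /andP[/andP[wk1 wk2] /andP[/andP[we wmu] /andP[wdel wpi]]].
have w0 : 0 < w by apply: (modulus_gt0 om); rewrite divr_gt0.
have nu0 : 0 < gam * l by rewrite mulr_gt0.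
set h := pi / (gam * l).
have h0 : 0 < h by rewrite divr_gt0// pi_gt0.
have hdel : h <= del / 8.
  rewrite /h ler_pdivrMr//; move: lpi; rewrite ler_pdivrMr ?mulr_gt0//.
  by clear; lra.
pose N := Num.truncn (del / 4 / h).
have /andP[N1 N2] : N%:R <= del / 4 / h < N.+1%:R.
  by apply: truncn_itv; rewrite divr_ge0 ?(ltW h0)// divr_ge0 ?(ltW del0).
have {}N1 : N%:R * h <= del / 4 by rewrite -ler_pdivlMr.
have {}N2 : del / 8 <= N%:R * h.
  have e : N.+1%:R * h = N%:R * h + h by rewrite -[N.+1%:R]natr1; ring.
  by move: N2 hdel; rewrite ltr_pdivrMr// e; clear; lra.
have N0 : (0 < N)%N.
  by rewrite lt0n; apply/eqP => N0; move: N2 del0; rewrite N0 mul0r; clear; lra.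
have tN0 : 0 < N%:R * h by move: N2 del0; clear; lra.
have tNT : N%:R * h < T0 by move: N1 delT T00; clear; lra.
have kw1 : 16 * (kap ^+ 2 * w) <= 1.
  have k16 : 0 < 16 * kap ^+ 2 by apply: mulr_gt0 => //; exact: exprn_gt0.
  by move: wk1; rewrite ler_pdivlMr//; clear; lra.
have kw2 : kap * w <= 1 by move: wk2; rewrite ler_pdivlMr// mulrC.
pose a i := if (i < N)%N then kap * Num.min (l * w) (theta (i.+1%:R * h)) else 0.
have [c [c' [[dc cc' cmu cg cth] [cE com]]]] :=
  perturbation om th0 thn mu12 eta0 del0 delT gam0 l0 kap0 e00 dg cg' gmu gom gth g0 g'0
    gk g2k kw1 kw2 we wmu wdel N1.
rewrite -/h -/w -/a in cE.
have hcPS : in_PS T0 mu1 mu2 omega theta c.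
  by apply: (C1_in_PS T00 dc cc') => // x _; exact: cmu.
exists c; split => //.
  move=> x xI; have -> : c x - c0 x = (c x - g x) + (g x - c0 x) by ring.
  apply: (le_trans (ler_normD _ _)).
  by have := cg x; have := gc0 x xI; clear; lra.
exists n => //; rewrite -/l.
have nodeI i : (i < N)%N -> i.+1%:R * h \in `]0, T0[.
  move=> iN; rewrite in_itv/= mulr_gt0 ?ltr0n//=.
  have : i.+1%:R * h <= N%:R * h by rewrite ler_pM2r// ler_nat.
  by move: tNT; clear; lra.
have lw0 : 0 < l * w by rewrite mulr_gt0.
have a0 i : 0 <= a i.
  rewrite /a; case: ifP => // iN; rewrite mulr_ge0 ?(ltW kap0)// le_min.
  by rewrite (ltW lw0)/= ltW// th0// nodeI.
have aM i : a i <= kap * (l * w).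
  rewrite /a; case: ifP => _; last by rewrite mulr_ge0// ltW.
  by rewrite ler_pM2l// ge_min lexx.
have [v [v1 [dv dv1 v00 v10 hvN]]] := resonant_solution nu0 a0 aM.
have [_ v1N] := hvN N; rewrite -/h in v1N.
set beta := \sum_(0 <= i < N) _ in v1N.
have beta0 : 0 <= beta.
  by apply: sumr_ge0 => i _; rewrite mulr_ge0 ?a0// mulr_ge0 ?(ltW h0)//.
have betaE : beta = 3 / 8 * kap *
    \sum_(0 <= i < N) Num.min (l * w) (theta (i.+1%:R * h)) * h.
  rewrite /beta mulr_sumr; apply: eq_big_nat => i /andP[_ iN].
  by rewrite /a iN; ring.
have mgrid := m_lambda_grid T00 om th0 thc thn l0 h0 N0 tNT.
rewrite -/m -/w in mgrid.
have thN : theta (N%:R * h) <= th.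
  by apply: thn => //; rewrite in_itv/= tN0.
have beta_ge : 3 / 4 * kap * (m l - (1 + th * T0)) <= 2 * beta.
  rewrite betaE; set s := \sum_(_ <= _ < _) _ in mgrid *.
  have lwh : l * w * h <= 1.
    rewrite (_ : l * w * h = w * pi / gam); last by rewrite /h; field; rewrite !gt_eqF.
    by move: wpi; rewrite ler_pdivlMr ?pi_gt0// ler_pdivrMr// mul1r.
  have thT : theta (N%:R * h) * T0 <= th * T0 by rewrite ler_pM2r.
  rewrite (_ : 2 * _ = 3 / 4 * kap * s); last by field.
  by rewrite ler_pM2l ?mulr_gt0//; move: mgrid lwh thT; clear; lra.
have hv1 x : x \in `]0, N%:R * h[ -> has_deriv v1 x (- (l ^+ 2 * c x * v x)).
  rewrite in_itv/= => /andP[x0 xN]; have := dv1 x.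
  (* Left of the last node [g] equals [gam ^ 2], so [l ^ 2 * c] is exactly the resonant coefficient
     [nu ^ 2 - osc]. *)
  rewrite (_ : - (_ - _) * _ = - (l ^+ 2 * c x * v x))//.
  rewrite cE (g0 x) -?gam2; last by move: xN N1 del0; clear; lra.
  by field; rewrite gt_eqF.
have ck x : x \in `]N%:R * h, T0[ -> `|c' x| <= th.
  rewrite in_itv/= => /andP[Nx xT].
  have xI : x \in `]0, T0[ by rewrite in_itv/= xT (lt_trans tN0).
  by apply: (le_trans (cth x xI)); apply: thn => //; exact: le_trans N2 (ltW Nx).
have [r r0 hr] := robust_growth mu10 (ltW mu12) l0 tN0 tNT beta0 (ltW thpos) dc
  (fun x _ => cmu x) ck dv hv1 (has_deriv_continuous dv1) v00 v10 v1N.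
exists r => // d u u' hd hu u0 u'0 t taut tT.
have tNt : N%:R * h <= t by move: N1 taut deltau del0; clear; lra.
have := hr d u u' hd hu u0 u'0 t tNt tT; rewrite -/mn -/mx.
set E := _ + _ => hE.
have {}hE : expR (2 * beta - (1 + th * T0 / mu1) - D0) <= E.
  rewrite -addrA -opprD expRD expRN expRD D0E.
  rewrite ler_pdivrMr; last by rewrite mulr_gt0 ?expR_gt0// divr_gt0// mulr_gt0.
  move: hE; rewrite -(ler_pM2l (_ : 0 < 4 / mn)) ?divr_gt0//.
  rewrite (_ : _ * (mn * _) = expR (2 * beta)); last by field; rewrite gt_eqF.
  by move=> /le_trans; apply; rewrite le_eqVlt; apply/orP; left; apply/eqP; field; rewrite gt_eqF.
rewrite mulNr expRN ler_pdivlMr ?expR_gt0// mul1r; apply: le_trans hE.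
rewrite ler_expR.
have h1 : C3 <= 2 * M3 * m l by move: mn_; rewrite ler_pdivrMr ?mulr_gt0//; clear; lra.
have ml0 : 0 <= m l.
  have D00 : 0 <= D0.
    rewrite ln_ge0// ler_pdivlMr// mul1r.
    have : mn <= 1 by rewrite ge_min lexx.
    by move: mx1; clear; lra.
  have C30 : 0 <= C3.
    have t1 : 0 < th * T0 by rewrite mulr_gt0.
    have t2 : 0 < th * T0 / mu1 by rewrite divr_gt0.
    have t3 : 0 < 3 / 4 * kap * (1 + th * T0) by rewrite !mulr_gt0// addr_gt0.
    by rewrite /C3; move: t1 t2 t3 D00; clear; lra.
  by apply: le_trans mn_; rewrite divr_ge0// mulr_ge0// ltW.
(* The exponent is at least [3 / 4 * kap * m l - C3], hence at least
   [3 * M3 * m l - 2 * M3 * m l]. *)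
have h2 : 4 * M3 * m l <= kap * m l by apply: ler_wpM2r.
by move: h1 h2 beta_ge; rewrite /C3; clear; lra.
Unshelve. all: by end_near. Qed.

Lemma PS_ball_pointwise (R : realType) (T0 mu1 mu2 r : R) (omega theta : R -> R)
    (c d : PS T0 mu1 mu2 omega theta) : 0 < T0 -> PS_ball c r d ->
  forall x, x \in `[0, T0] -> `|d x - c x| <= r.
Proof.
move=> T00 cd x xI; rewrite distrC.
have [cc _ _ _] := PS_funP c; have [cd' _ _ _] := PS_funP d.
exact: (Linfty_dist_pointwise T00 cc cd' cd).
Qed.

Theorem theorem2p3 (R : realType) (T0 mu1 mu2 : R) (omega theta : R -> R)
    (T0_gt0 : 0 < T0) (mu1_gt0 : 0 < mu1) (mu12 : mu1 < mu2)
    (omegaP : modulus_of_continuity omega)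
    (theta_gt0 : {in `]0, T0[, forall t, 0 < theta t})
    (theta_cont : {in `]0, T0[, continuous theta})
    (theta_noninc : {in `]0, T0[ &, {homo theta : x y /~ x <= y}}) :
  let m := m_lambda T0 omega theta in
  let M1 := (Num.max 1 mu2 / Num.min 1 mu1) ^+ 2 in
  let M2 := 1 / mu1 + 1 / Num.sqrt mu1 in
  let M3 := 1 / (128 * mu2) * Num.min 1 (Num.sqrt mu1 / pi) in
  (forall (c : PS T0 mu1 mu2 omega theta) (lambda : R), 0 < lambda ->
    forall u u' : R -> R, solves T0 lambda c u u' ->
    forall t, t \in `[0, T0] ->
      u' t ^+ 2 + lambda ^+ 2 * u t ^+ 2 <=
      M1 * (u' 0 ^+ 2 + lambda ^+ 2 * u 0 ^+ 2) * expR (M2 * m lambda))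
  /\
  (m lambda @[lambda --> +oo] --> +oo ->
    forall lam : nat -> R, (forall n, 0 < lam n) -> lam n @[n --> \oo] --> +oo ->
    residual [set c : PS T0 mu1 mu2 omega theta |
      forall u u' : nat -> R -> R,
        (forall n, [/\ solves T0 (lam n) c (u n) (u' n),
                       u n 0 = 0 & u' n 0 = 1]) ->
        forall t, t \in `]0, T0] ->
          (1 <= limn_esup (fun n =>
            ((`|u' n t| ^+ 2 + lam n ^+ 2 * `|u n t| ^+ 2) *
             expR (- M3 * m (lam n)))%:E))%E]).
Proof.
move=> m M1 M2 M3; split.
  move=> c lambda lambda0 u u' hu t tI.
  exact: (energy_upper_bound T0_gt0 mu1_gt0 omegaP theta_gt0 theta_cont
    theta_noninc (PS_funP c) lambda0 mu12 hu tI).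
move=> mcvg lam lam0 lamcvg.
pose X := PS T0 mu1 mu2 omega theta.
(* Growth on a compact part of [(0, T0]] for one index beyond [k]. Taking interiors makes openness
   automatic, and [dense_growth] supplies a whole ball inside [B k]. *)
pose B (k : nat) : set X := [set d | exists2 n, (k <= n)%N & forall u u' : R -> R,
  solves T0 (lam n) d u u' -> u 0 = 0 -> u' 0 = 1 ->
  forall t, k.+1%:R^-1 <= t -> t <= T0 ->
    1 <= (u' t ^+ 2 + lam n ^+ 2 * u t ^+ 2) * expR (- M3 * m (lam n))].
exists (fun k => interior (B k)) => [k|].
  split; first exact: open_interior.
  move=> O [c0 Oc0] oO.
  have /nbhs_ballP[e /= e0 he] : nbhs c0 O by exact: open_nbhs_nbhs.
  have k0 : 0 < k.+1%:R^-1 :> R by rewrite invr_gt0.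
  have [c [cPS cc0 [n kn [r r0 hr]]]] := dense_growth k T0_gt0 mu1_gt0 mu12 omegaP
    theta_gt0 theta_cont theta_noninc mcvg lam0 lamcvg (PS_funP c0) e0 k0.
  exists (MkPS cPS : X); split.
    apply: he; rewrite /ball/=/PS_ball/=.
    apply: (@le_lt_trans _ _ (e * (3 / 4))%:E).
      apply: Linfty_dist_le; first by rewrite mulr_ge0// ltW.
      by move=> x xI; rewrite distrC cc0//; exact: subset_itv_oo_cc.
    by rewrite lte_fin; lra.
  apply/nbhs_ballP; exists r => //= d cd; exists n => // u u' hu u0 u'0 t.
  by apply: (hr d) => //; exact: (@PS_ball_pointwise _ _ _ _ _ _ _ (MkPS cPS) d T0_gt0 cd).
move=> d hd u u' hu t; rewrite in_itv/= => /andP[t0 tT].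
(* As soon as [1 / (k + 1) <= t], membership in [B k] gives an index beyond [k] with value at least
   1, so each tail supremum is at least 1. *)
rewrite limn_esup_lim; apply: lime_ge; first exact: is_cvg_esups.
near=> k.
have /interior_subset[n kn hn] := hd k I.
have [hs u0 u'0] := hu n.
have kt : k.+1%:R^-1 <= t.
  by apply: ltW; near: k; exact: (near_infty_natSinv_lt (PosNum t0)).
have := hn _ _ hs u0 u'0 t kt tT => h1.
apply: (@le_trans _ _ ((`|u' n t| ^+ 2 + lam n ^+ 2 * `|u n t| ^+ 2) *
             expR (- M3 * m (lam n)))%:E).
  by rewrite lee_fin !real_sqr_norm.
by apply: ereal_sup_ubound; exists n.
Unshelve. all: by end_near. Qed.
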